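(* Let $A\subseteq\mathbb{N}$ be a noncomputable c.e. set, let $h$ be an $A$-hash, and let $f$ be the $h$-shuffle (with respect to any computable enumeration $(a_i)$ of $A$ without repetitions). Then $f$ is (i) total computable and random-preserving; (ii) surjective and nowhere injective (that is, $f^{-1}(y)$ is uncountable for each $y\in2^\omega$); (iii) oneway relative to each real $w$ with $w\not\geq_T A$.
   Context: Reals are elements of $2^\omega$ and strings are elements of $2^{<\omega}$; $x\upharpoonright_n$ is the prefix of $x$ of length $n$; $\mu$ is the uniform measure on $2^\omega$; $x\oplus y$ is the real $z$ with $z(2n)=x(n)$, $z(2n+1)=y(n)$; $\otimes$ is XOR of bits. ''Random'' means Martin-Löf random. For an infinite c.e. set $A\subseteq\mathbb{N}$, an $A$-hash is a computable function $h:\{\sigma\in 2^{<\omega}: |\sigma|\in A\}\to\{0,1\}$ (i.e. a partial computable function with exactly this domain). Given a computable enumeration $(a_i)$ of $A$ without repetitions, the $h$-shuffle is $f:2^\omega\to2^\omega$ given by $f(x)(i):=x(a_i)\otimes h(x\upharpoonright_{a_i})$. A partial function $g:\subseteq 2^\omega\to 2^\omega$ is partial $w$-computable, written $g\leq_T w$, if there is an oracle Turing machine that, with oracles $x$ and $w$, outputs successive bits of $g(x)$; $g(x)$ is defined exactly when infinitely many bits are output. A partial function $g$ is a probabilistic inversion of $f$ if $\mu(\{y\oplus r: f(g(y\oplus r))=y\})>0$. $f$ is random-preserving if $\mu(\mathsf{dom}(f))>0$ and $f(x)$ is random for each random $x\in\mathsf{dom}(f)$, where $\mathsf{dom}(f)$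 is the domain of $f$. $f$ is oneway relative to $w$ if it is partial computable, random-preserving, and has no probabilistic inversion $g\leq_T w$. *)

(* Defs.v *)
From mathcomp Require Import all_boot all_order all_algebra.
From mathcomp Require Import all_classical all_reals all_analysis.
From Stdlib Require Cantor.

Set Implicit Arguments.
Unset Strict Implicit.
Unset Printing Implicit Defensive.

Import Order.TTheory GRing.Theory Num.Theory.
Local Open Scope classical_set_scope.

(* Reals are elements of [cantor_space], i.e. functions [nat -> bool];
   strings are elements of [seq bool]. *)

Definition real_prefix (x : cantor_space) (n : nat) : seq bool := mkseq x n.

Definition cylinder (s : seq bool) : set cantor_space :=
  [set x | real_prefix x (size s) = s].

Definition real_join (x y : cantor_space) : cantor_space :=
  fun n => if odd n then y n./2 else x n./2.

(* Oracle machines, presented as partial recursive functions relative to an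
   oracle: each program denotes a unary partial function, with pairs passed
   through the bijection [Cantor.to_nat]. *)
Inductive rcode : Type :=
  | PZero
  | PSucc
  | PLeft
  | PRight
  | POracle
  | PPair of rcode & rcode
  | PComp of rcode & rcode
  | PPrec of rcode & rcode
  | PMu of rcode.

Definition npair (m n : nat) : nat := Cantor.to_nat (m, n).

(* [primrec P Q m k y]: [y] is the value at [(m, k)] of the function obtained by
   primitive recursion on [k] from the base case [P] and the step [Q]. *)
Fixpoint primrec (P Q : nat -> nat -> Prop) (m k y : nat) : Prop :=
  if k is k'.+1
  then exists2 z, primrec P Q m k' z & Q (npair m (npair k' z)) y
  else P m y.

(* [run O c n y]: the computation of [c] with oracle [O] on input [n] halts
   with output [y]. *)
Fixpoint run (O : cantor_space) (c : rcode) (n y : nat) : Prop :=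
  match c with
  | PZero => y = 0
  | PSucc => y = n.+1
  | PLeft => y = (Cantor.of_nat n).1
  | PRight => y = (Cantor.of_nat n).2
  | POracle => y = O n
  | PPair c1 c2 =>
      exists y1 y2, [/\ run O c1 n y1, run O c2 n y2 & y = npair y1 y2]
  | PComp c1 c2 => exists2 m, run O c2 n m & run O c1 m y
  | PPrec c1 c2 => primrec (run O c1) (run O c2)
                    (Cantor.of_nat n).1 (Cantor.of_nat n).2 y
  | PMu c1 => run O c1 (npair n y) 0 /\
             forall k, k < y -> exists v, run O c1 (npair n k) v.+1
  end.

(* Computation without an oracle is computation with this trivial oracle. *)
Definition zero_real : cantor_space := fun _ => false.

(* Bijection from strings to natural numbers. *)
Definition string_code (s : seq bool) : nat :=
  foldr (fun (b : bool) m => (m.*2 + b).+1) 0 s.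

Definition computable_fun (a : nat -> nat) : Prop :=
  exists c, forall n, run zero_real c n (a n).

Definition ce_set (A : set nat) : Prop :=
  exists c, A = [set n | exists y, run zero_real c n y].

Definition char_real (A : set nat) : cantor_space := fun n => n \in A.

Definition turing_le (x y : cantor_space) : Prop :=
  exists c, forall n, run y c n (x n).

Definition computable_set (A : set nat) : Prop :=
  turing_le (char_real A) zero_real.

Definition computable_string_fun (h : seq bool -> option bool) : Prop :=
  exists c, forall s y,
    run zero_real c (string_code s) y <-> omap nat_of_bool (h s) = Some y.

Definition is_hash (A : set nat) (h : seq bool -> option bool) : Prop :=
  computable_string_fun h /\ forall s, h s != None <-> A (size s).

Definition computable_enumeration (A : set nat) (a : nat -> nat) : Prop :=
  [/\ computable_fun a, injective a & range a = A].

(* The default value is irrelevant when [h] is an [A]-hash and [a] enumerates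
   [A], since then [h] is defined at every [real_prefix x (a i)]. *)
Definition shuffle (a : nat -> nat) (h : seq bool -> option bool)
    (x : cantor_space) : cantor_space :=
  fun i => x (a i) (+) odflt false (h (real_prefix x (a i))).

Definition partial_map : Type := cantor_space -> option cantor_space.

Definition as_partial (f : cantor_space -> cantor_space) : partial_map :=
  fun x => Some (f x).

Definition pdom (g : partial_map) : set cantor_space := [set x | g x <> None].

(* The [n]-th bit output by the machine [c] is its value on input [n]; for
   infinitely many bits to be output all of these computations must halt. *)
Definition outputs_real (O : cantor_space) (c : rcode) (z : cantor_space) : Prop :=
  forall n, run O c n (z n).

Definition partial_computable (g : partial_map) : Prop :=
  exists c, forall x z, g x = Some z <-> outputs_real x c z.

Definition partial_computable_in (w : cantor_space) (g : partial_map) : Prop :=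
  exists c, forall x z, g x = Some z <-> outputs_real (real_join x w) c z.

Definition total_computable (g : partial_map) : Prop :=
  partial_computable g /\ pdom g = setT.

(* The uniform measure, extended to all sets as an outer measure: the infimum of
   the total weights of countable covers by cylinders.  Below it is
   only relevant on Borel sets. *)
Definition uniform_mu (R : realType) (E : set cantor_space) : \bar R :=
  ereal_inf [set (\sum_(0 <= k <oo) ((2 ^- size (s k))%R : R)%:E)%E
            | s in [set s : nat -> seq bool |
                     E `<=` \bigcup_k cylinder (s k)]].

Definition ml_test (R : realType) (U : nat -> set cantor_space) : Prop :=
  (exists c, forall n, U n =
     \bigcup_(s in [set s | exists y,
                     run zero_real c (npair n (string_code s)) y]) cylinder s)
  /\ forall n, (uniform_mu R (U n) <= ((2 ^- n)%R : R)%:E)%E.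

Definition ml_random (R : realType) (x : cantor_space) : Prop :=
  forall U, ml_test R U -> ~ (\bigcap_n U n) x.

Definition random_preserving (R : realType) (f : partial_map) : Prop :=
  (0 < uniform_mu R (pdom f))%E /\
  forall x y, f x = Some y -> ml_random R x -> ml_random R y.

(* [obind f (g v) = Some y] says that [g v] is defined, that [f] is defined
   there, and that [f (g v) = y]. *)
Definition probabilistic_inversion (R : realType) (g f : partial_map) : Prop :=
  (0 < uniform_mu R [set v | exists y r, v = real_join y r /\ obind f (g v) = Some y])%E.

Definition oneway (R : realType) (w : cantor_space) (f : partial_map) : Prop :=
  [/\ partial_computable f,
      random_preserving R f &
      forall g, partial_computable_in w g -> ~ probabilistic_inversion R g f].

Definition real_surjective (f : cantor_space -> cantor_space) : Prop :=
  forall y, exists x, f x = y.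

Definition nowhere_injective (f : cantor_space -> cantor_space) : Prop :=
  forall y, ~ countable (f @^-1` [set y]).

(* Main.v *)
Require Import Defs.
From mathcomp Require Import all_boot all_order all_algebra.
From mathcomp Require Import all_classical all_reals all_analysis.
From mathcomp Require Import lra.
From Stdlib Require Cantor.

(** Part (i): a cylinder constrains [x] at finitely many distinct positions [a i],
    each time to a value determined by the earlier bits of [x], so its preimage
    under the shuffle has the same measure; hence preimages of Martin-Löf tests
    are Martin-Löf tests.

    Part (ii): a preimage of [y] is built bit by bit, with the bits outside [A]
    chosen freely; [A] is co-infinite because it is not computable.

    Part (iii): let a machine with oracle [w] invert the shuffle on a set [G].  On
    a cylinder [[t]], search for each [n] for a stage [k] at which more than 2/3
    of the extensions of [t] by [k] bits make the machine output the bits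
    [0, ..., n].  If no stage is found for some [n], then at most 2/3 of [[t]]
    meets [G].  If [n = a i] and the bit [2 i] was not yet queried at stage [k],
    then that bit is independent of the output which predicts it, so at least
    1/3 of [[t]] misses [G].  If neither ever happens, then [n] is in [A] exactly
    when it is enumerated before stage [size t + k], so [A] is computable in [w].
    Hence if [A] is not computable in [w], then [G] fills at most 2/3 of every
    cylinder, and by iteration it is null. *)

Set Implicit Arguments.
Unset Strict Implicit.
Unset Printing Implicit Defensive.

(** * Closure properties of oracle computation *)

Definition fstn (n : nat) : nat := (Cantor.of_nat n).1.
Definition sndn (n : nat) : nat := (Cantor.of_nat n).2.

Lemma fstn_pair m n : fstn (npair m n) = m.
Proof. by rewrite /fstn /npair Cantor.cancel_of_to. Qed.

Lemma sndn_pair m n : sndn (npair m n) = n.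
Proof. by rewrite /sndn /npair Cantor.cancel_of_to. Qed.

Lemma npairK n : npair (fstn n) (sndn n) = n.
Proof.
by rewrite /npair /fstn /sndn -surjective_pairing Cantor.cancel_to_of.
Qed.

Lemma leq_npair m n : m + n <= npair m n.
Proof.
by rewrite addnC; apply/leP; exact: (Cantor.to_nat_non_decreasing m n).
Qed.

Lemma fstn_leq n : fstn n <= n.
Proof. by rewrite -{2}[n]npairK (leq_trans _ (leq_npair _ _)) ?leq_addr. Qed.

Lemma sndn_leq n : sndn n <= n.
Proof. by rewrite -{2}[n]npairK (leq_trans _ (leq_npair _ _)) ?leq_addl. Qed.

Lemma run_det O c n y1 y2 : run O c n y1 -> run O c n y2 -> y1 = y2.
Proof.
elim: c n y1 y2 => [|||||c1 IH1 c2 IH2|c1 IH1 c2 IH2|c1 IH1 c2 IH2|c IH] n y1 y2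
  /=; try by move=> -> ->.
- move=> [u1 [v1 [ru1 rv1 ->]]] [u2 [v2 [ru2 rv2 ->]]].
  by rewrite (IH1 _ _ _ ru1 ru2) (IH2 _ _ _ rv1 rv2).
- move=> [m1 r1 s1] [m2 r2 s2].
  by rewrite (IH2 _ _ _ r1 r2) in s1; exact: IH1 s1 s2.
- elim: (Cantor.of_nat n).2 y1 y2 => [|k IHk] y1 y2 /=; first exact: IH1.
  move=> [z1 p1 r1] [z2 p2 r2].
  by rewrite (IHk _ _ p1 p2) in r1; exact: IH2 r1 r2.
- move=> [r1 m1] [r2 m2]; case: (ltngtP y1 y2) => // lt_y.
  + by have [v /(IH _ _ _ r1)] := m2 _ lt_y.
  + by have [v /(IH _ _ _ r2)] := m1 _ lt_y.
Qed.

(** Answering every query by 0 simulates the trivial oracle. Programs given relative to [zero_real],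
    such as those for [a] and [h], can thus be used inside machines with any oracle. *)
Fixpoint unoracle (c : rcode) : rcode :=
  match c with
  | POracle => PZero
  | PPair c1 c2 => PPair (unoracle c1) (unoracle c2)
  | PComp c1 c2 => PComp (unoracle c1) (unoracle c2)
  | PPrec c1 c2 => PPrec (unoracle c1) (unoracle c2)
  | PMu c1 => PMu (unoracle c1)
  | _ => c
  end.

Lemma run_unoracle O c n y : run zero_real c n y -> run O (unoracle c) n y.
Proof.
elim: c n y => [|||||c1 IH1 c2 IH2|c1 IH1 c2 IH2|c1 IH1 c2 IH2|c IH] n y //=.
- by move=> [y1 [y2 [/IH1 r1 /IH2 r2 ->]]]; exists y1, y2.
- by move=> [m /IH2 r2 /IH1 r1]; exists m.
- elim: (Cantor.of_nat n).2 y => [|k IHk] y /=; first exact: IH1.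
  by move=> [z /IHk p /IH2 r]; exists z.
- move=> [/IH r0 m]; split=> // k /m [v /IH rv]; by exists v.
Qed.

(** A single program must work for all oracles in [X]: [setT] gives uniform functionals of the
    oracle, a singleton gives computability relative to one real. *)
Definition computes (X : set cantor_space) (F : cantor_space -> nat -> nat) :=
  exists c, forall O n, X O -> run O c n (F O n).

Section Closure.
Variable X : set cantor_space.
Local Notation computes := (computes X).
Implicit Types F G : cantor_space -> nat -> nat.

Lemma computes_ext F G : (forall O n, F O n = G O n) -> computes F -> computes G.
Proof. by move=> FG [c hc]; exists c => O n XO; rewrite -FG; exact: hc. Qed.

Lemma computes_id : computes (fun _ n => n).
Proof.
exists (PPair PLeft PRight) => O n XO /=.
by exists (fstn n), (sndn n); split=> //; rewrite npairK.
Qed.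

(** [c] has to halt only on the values of [F], so it may denote a partial function; the hash is used
    in this way. *)
Lemma computes_run c F G :
  (forall O n, X O -> run zero_real c (F O n) (G O n)) -> computes F -> computes G.
Proof.
move=> hc [cF hF]; exists (PComp (unoracle c) cF) => O n XO /=.
by exists (F O n); [exact: hF | apply/run_unoracle/hc].
Qed.

Lemma computes_comp F G : computes G -> computes F ->
  computes (fun O n => G O (F O n)).
Proof.
move=> [cG hG] [cF hF]; exists (PComp cG cF) => O n XO /=.
by exists (F O n); [exact: hF | exact: hG].
Qed.

Lemma computes_fun (f : nat -> nat) F : computable_fun f -> computes F ->
  computes (fun O n => f (F O n)).
Proof. by move=> [c hc]; apply: (@computes_run c) => O n _; exact: hc. Qed.

Lemma computes_zero : computes (fun _ _ => 0).
Proof. by exists PZero. Qed.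

Lemma computes_succ F : computes F -> computes (fun O n => (F O n).+1).
Proof. by apply: (@computes_comp F (fun _ n => n.+1)); exists PSucc. Qed.

Lemma computes_fst F : computes F -> computes (fun O n => fstn (F O n)).
Proof. by apply: (@computes_comp F (fun _ n => fstn n)); exists PLeft. Qed.

Lemma computes_snd F : computes F -> computes (fun O n => sndn (F O n)).
Proof. by apply: (@computes_comp F (fun _ n => sndn n)); exists PRight. Qed.

Lemma computes_oracle F : computes F -> computes (fun O n => O (F O n)).
Proof. by apply: (@computes_comp F (fun O n => O n)); exists POracle. Qed.

Lemma computes_const k : computes (fun _ _ => k).
Proof. by elim: k => [|k IH]; [exact: computes_zero | exact: computes_succ]. Qed.

Lemma computes_pair F G : computes F -> computes G ->
  computes (fun O n => npair (F O n) (G O n)).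
Proof.
move=> [cF hF] [cG hG]; exists (PPair cF cG) => O n XO /=.
by exists (F O n), (G O n); split; [exact: hF | exact: hG |].
Qed.

Lemma computes2 (H : cantor_space -> nat -> nat -> nat) F G :
  computes (fun O e => H O (fstn e) (sndn e)) -> computes F -> computes G ->
  computes (fun O n => H O (F O n) (G O n)).
Proof.
move=> hH hF hG; have := computes_comp hH (computes_pair hF hG).
by apply: computes_ext => O n; rewrite fstn_pair sndn_pair.
Qed.

Lemma computes_iteri K B (S : cantor_space -> nat -> nat -> nat -> nat) :
  computes K -> computes B ->
  computes (fun O e => S O (fstn e) (fstn (sndn e)) (sndn (sndn e))) ->
  computes (fun O n => iteri (K O n) (S O n) (B O n)).
Proof.
move=> hK [cB hB] [cS hS].
have [cI hI] := computes_pair computes_id hK.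
exists (PComp (PPrec cB cS) cI) => O n XO /=.
exists (npair n (K O n)); first exact: hI.
rewrite -/(fstn _) -/(sndn _) fstn_pair sndn_pair.
elim: (K O n) => [|k IH] /=; first exact: hB.
exists (iteri k (S O n) (B O n)) => //.
have := hS O (npair n (npair k (iteri k (S O n) (B O n)))) XO.
by rewrite !(fstn_pair, sndn_pair).
Qed.

Lemma computes_case Z B (S : cantor_space -> nat -> nat -> nat) :
  computes Z -> computes B -> computes (fun O e => S O (fstn e) (sndn e)) ->
  computes (fun O n => if Z O n is z.+1 then S O n z else B O n).
Proof.
move=> hZ hB hS.
have : computes (fun O n => iteri (Z O n) (fun k _ => S O n k) (B O n)).
  apply: (computes_iteri (S := fun O n k _ => S O n k)) => //.
  apply: (computes2 hS); first exact/computes_fst/computes_id.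
  exact/computes_fst/computes_snd/computes_id.
by apply: computes_ext => O n; case: (Z O n).
Qed.

Lemma computes_if Z F G : computes (fun O n => nat_of_bool (Z O n)) ->
  computes F -> computes G ->
  computes (fun O n => if (Z O n : bool) then F O n else G O n).
Proof.
move=> hZ hF hG.
have := computes_case (S := fun O n _ => F O n) hZ hG
  (computes_comp hF (computes_fst computes_id)).
by apply: computes_ext => O n; case: (Z O n).
Qed.

Lemma computes_add F G : computes F -> computes G ->
  computes (fun O n => F O n + G O n).
Proof.
move=> hF hG.
have := computes_iteri (S := fun _ _ _ z => z.+1) hF hG
  (computes_succ (computes_snd (computes_snd computes_id))).
by apply: computes_ext => O n; elim: (F O n) => //= k ->.
Qed.

Lemma computes_sum K (S : cantor_space -> nat -> nat -> nat) :
  computes K -> computes (fun O e => S O (fstn e) (sndn e)) ->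
  computes (fun O n => \sum_(0 <= j < K O n) S O n j).
Proof.
move=> hK hS.
have hstep : computes (fun O e => sndn (sndn e) + S O (fstn e) (fstn (sndn e))).
  apply: computes_add; first exact/computes_snd/computes_snd/computes_id.
  apply: (computes2 hS); first exact/computes_fst/computes_id.
  exact/computes_fst/computes_snd/computes_id.
have := computes_iteri (S := fun O n k z => z + S O n k) hK computes_zero hstep.
apply: computes_ext => O n; elim: (K O n) => [|k /= ->]; first by rewrite big_nil.
by rewrite big_nat_recr.
Qed.

Lemma computes_mul F G : computes F -> computes G ->
  computes (fun O n => F O n * G O n).
Proof.
move=> hF hG.
have := computes_sum (S := fun O n _ => F O n) hG
  (computes_comp hF (computes_fst computes_id)).
by apply: computes_ext => O n; rewrite sum_nat_const_nat subn0 mulnC.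
Qed.

Lemma computes_pred F : computes F -> computes (fun O n => (F O n).-1).
Proof.
move=> hF; have := computes_case (S := fun O n z => z) hF computes_zero
  (computes_snd computes_id).
by apply: computes_ext => O n; case: (F O n).
Qed.

Lemma computes_sub F G : computes F -> computes G ->
  computes (fun O n => F O n - G O n).
Proof.
move=> hF hG.
have := computes_iteri (S := fun _ _ _ z => z.-1) hG hF
  (computes_pred (computes_snd (computes_snd computes_id))).
apply: computes_ext => O n; elim: (G O n) => [|k /= ->]; first by rewrite subn0.
by rewrite subnS.
Qed.

Lemma computes_eq0 F : computes F -> computes (fun O n => nat_of_bool (F O n == 0)).
Proof.
move=> hF; have := computes_sub (computes_const 1) hF.
by apply: computes_ext => O n; case: (F O n) => [|[]].
Qed.

Lemma computes_neg (Z : cantor_space -> nat -> bool) :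
  computes (fun O n => Z O n) -> computes (fun O n => ~~ Z O n).
Proof.
by move=> /computes_eq0; apply: computes_ext => O n; case: (Z O n).
Qed.

Lemma computes_leq F G : computes F -> computes G ->
  computes (fun O n => nat_of_bool (F O n <= G O n)).
Proof. by move=> hF hG; exact: computes_eq0 (computes_sub hF hG). Qed.

Lemma computes_and (Y Z : cantor_space -> nat -> bool) :
  computes (fun O n => Y O n) -> computes (fun O n => Z O n) ->
  computes (fun O n => Y O n && Z O n).
Proof.
move=> hY hZ; have := computes_mul hY hZ.
by apply: computes_ext => O n; rewrite mulnb.
Qed.

Lemma computes_eq F G : computes F -> computes G ->
  computes (fun O n => nat_of_bool (F O n == G O n)).
Proof.
move=> hF hG; have := computes_and (computes_leq hF hG) (computes_leq hG hF).
by apply: computes_ext => O n; rewrite -eqn_leq.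
Qed.

Lemma computes_odd F : computes F -> computes (fun O n => odd (F O n)).
Proof.
move=> hF.
have := computes_iteri (S := fun _ _ _ z => z == 0) hF computes_zero
  (computes_eq0 (computes_snd (computes_snd computes_id))).
apply: computes_ext => O n; elim: (F O n) => //= k ->.
by case: (odd k).
Qed.

Lemma computes_addb (Y Z : cantor_space -> nat -> bool) :
  computes (fun O n => Y O n) -> computes (fun O n => Z O n) ->
  computes (fun O n => Y O n (+) Z O n).
Proof.
move=> hY hZ; have := computes_odd (computes_add hY hZ).
by apply: computes_ext => O n; case: (Y O n); case: (Z O n).
Qed.

Lemma computes_half F : computes F -> computes (fun O n => (F O n)./2).
Proof.
move=> hF; have := computes_sum (S := fun O n j => odd j) hF
  (computes_odd (computes_snd computes_id)).
apply: computes_ext => O n; elim: (F O n) => [|k IH]; first by rewrite big_nil.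
by rewrite big_nat_recr //= IH addnC -uphalf_half.
Qed.

Lemma computes_exp2 F : computes F -> computes (fun O n => 2 ^ F O n).
Proof.
move=> hF.
have := computes_iteri (S := fun _ _ _ z => 2 * z) hF (computes_const 1)
  (computes_mul (computes_const 2) (computes_snd (computes_snd computes_id))).
by apply: computes_ext => O n; elim: (F O n) => //= k ->; rewrite expnS.
Qed.

Lemma computes_mu (P : cantor_space -> nat -> nat -> nat) :
  computes (fun O e => P O (fstn e) (sndn e)) ->
  (forall O n, X O -> exists s, P O n s = 0) ->
  exists2 M, computes M & forall O n, X O -> P O n (M O n) = 0.
Proof.
move=> [c hc] exP.
have : forall On : cantor_space * nat, exists s, X On.1 ->
    P On.1 On.2 s = 0 /\ forall k, k < s -> P On.1 On.2 k != 0.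
  move=> [/= O n]; have [XO|nXO] := pselect (X O); last by exists 0.
  have exPn := exP O n XO.
  have exb : exists s, P O n s == 0 by have [s /eqP Ps] := exPn; exists s.
  exists (ex_minn exb); case: ex_minnP => m /eqP Pm min_m; split=> // k.
  by apply: contraTN => /min_m; rewrite -leqNgt.
move=> /choice [M hM]; exists (fun O n => M (O, n)); last first.
  by move=> O n XO; have [] := hM (O, n) XO.
exists (PMu c) => O n XO /=; have [P0 Pk] := hM (O, n) XO.
have hcO k : run O c (npair n k) (P O n k).
  by have := hc O (npair n k) XO; rewrite fstn_pair sndn_pair.
split=> [|k /Pk]; first by have := hcO (M (O, n)); rewrite P0.
by case E : (P O n k) => [//|v] _; exists v; rewrite -E.
Qed.

End Closure.

Ltac computability_hook := fail.

Ltac computability :=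
  repeat match goal with
  | H : computes ?X ?F |- computes ?X ?F => exact: H
  | |- computes _ (fun _ n => n) => exact: computes_id
  | |- computes _ (fun _ _ => 0) => exact: computes_zero
  | |- computes _ (fun _ _ => ?k) => exact: (computes_const _ k)
  | |- computes _ (fun O n => fstn (@?F O n)) => apply: (computes_fst (F := F))
  | |- computes _ (fun O n => sndn (@?F O n)) => apply: (computes_snd (F := F))
  | |- computes _ (fun O n => npair (@?F O n) (@?G O n)) =>
      apply: (computes_pair (F := F) (G := G))
  | |- computes _ (fun O n => nat_of_bool (odd (@?F O n))) =>
      apply: (computes_odd (F := F))
  | |- computes _ (fun O n => nat_of_bool (@?F O n == 0)) =>
      apply: (computes_eq0 (F := F))
  | |- computes _ (fun O n => nat_of_bool (@?F O n == @?G O n)) =>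
      apply: (computes_eq (F := F) (G := G))
  | |- computes _ (fun O n => nat_of_bool (@?F O n <= @?G O n)) =>
      apply: (computes_leq (F := F) (G := G))
  | |- computes _ (fun O n => nat_of_bool (~~ @?F O n)) =>
      apply: (computes_neg (Z := F))
  | |- computes _ (fun O n => nat_of_bool (@?F O n && @?G O n)) =>
      apply: (computes_and (Y := F) (Z := G))
  | |- computes _ (fun O n => nat_of_bool (@?F O n (+) @?G O n)) =>
      apply: (computes_addb (Y := F) (Z := G))
  | |- computes _ (fun O n => nat_of_bool (O (@?F O n))) =>
      apply: (computes_oracle (F := F))
  | |- computes _ (fun O n => half (@?F O n)) => apply: (computes_half (F := F))
  | |- computes _ (fun O n => S (@?F O n)) => apply: (computes_succ (F := F))
  | |- computes _ (fun O n => predn (@?F O n)) => apply: (computes_pred (F := F))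
  | |- computes _ (fun O n => 2 ^ (@?F O n)) => apply: (computes_exp2 (F := F))
  | |- computes _ (fun O n => @?F O n + @?G O n) =>
      apply: (computes_add (F := F) (G := G))
  | |- computes _ (fun O n => @?F O n * @?G O n) =>
      apply: (computes_mul (F := F) (G := G))
  | |- computes _ (fun O n => @?F O n - @?G O n) =>
      apply: (computes_sub (F := F) (G := G))
  | |- computes _ (fun O n => \sum_(0 <= j < @?K O n) @?S O n j) =>
      apply: (computes_sum (K := K) (S := S))
  | |- computes _ (fun O n => iteri (@?K O n) (@?S O n) (@?B O n)) =>
      apply: (computes_iteri (K := K) (S := S) (B := B))
  | |- computes _ _ => computability_hook
  end.

(** * Strings as numbers and the bounded evaluator *)

(** [string_code] writes a string in base two with digits 1 and 2, the first bit being the least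
    significant digit. Predecessor and halving remove this digit; the parity of the predecessor
    reads it. A string is no longer than its code, which bounds the sum in [code_size]. *)
Definition code_drop (j p : nat) : nat := iter j (fun p => p.-1./2) p.
Definition code_nth (p j : nat) : bool := odd (code_drop j p).-1.
Definition code_size (p : nat) : nat := \sum_(0 <= j < p) (code_drop j p != 0).

Lemma string_code_cons b s : string_code (b :: s) = ((string_code s).*2 + b).+1.
Proof. by []. Qed.

Lemma code_dropE j s : code_drop j (string_code s) = string_code (drop j s).
Proof.
elim: j s => [|j IH] s; first by rewrite drop0.
rewrite /code_drop iterSr; case: s => [|b s]; first exact: (IH [::]).
by rewrite string_code_cons /= addnC half_bit_double; exact: IH.
Qed.

Lemma code_nthE s j : code_nth (string_code s) j = nth false s j.
Proof.
rewrite /code_nth code_dropE -{2}[j]addn0 -nth_drop; case: (drop j s) => [|b t] //.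
by rewrite string_code_cons /= oddD odd_double; case: b.
Qed.

Lemma string_code_eq0 s : (string_code s == 0) = nilp s.
Proof. by case: s. Qed.

Lemma code_drop_eq0 j s : (code_drop j (string_code s) == 0) = (size s <= j).
Proof. by rewrite code_dropE string_code_eq0 /nilp size_drop subn_eq0. Qed.

Lemma size_leq_string_code s : size s <= string_code s.
Proof.
elim: s => // b s IH; rewrite string_code_cons /= ltnS.
by apply: leq_trans IH _; rewrite -addnn -addnA leq_addr.
Qed.

Lemma code_sizeE s : code_size (string_code s) = size s.
Proof.
rewrite /code_size; under eq_bigr do rewrite code_drop_eq0 -ltnNge.
have := size_leq_string_code s; elim: (string_code s) => [|k IH].
  by rewrite leqn0 big_nil => /eqP.
rewrite leq_eqVlt => /orP[/eqP ->|].
  rewrite (eq_big_nat _ _ (F2 := fun _ => 1)); last by move=> i /andP[_ ->].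
  by rewrite sum_nat_const_nat subn0 muln1.
by rewrite ltnS => sk; rewrite big_nat_recr //= IH // ltnNge sk addn0.
Qed.

Lemma string_code_cat s t :
  string_code (s ++ t) = string_code s + 2 ^ size s * string_code t.
Proof.
elim: s => [|b s IH]; first by rewrite mul1n.
by rewrite cat_cons !string_code_cons IH expnS -mulnA mul2n doubleD addnAC.
Qed.

Lemma string_code_mkseq (u : nat -> bool) n :
  string_code (mkseq u n) = \sum_(0 <= j < n) (u j).+1 * 2 ^ j.
Proof.
elim: n => [|n IH]; first by rewrite big_nil.
rewrite mkseqS -cats1 string_code_cat size_mkseq IH big_nat_recr //=.
by rewrite add0n mulnC.
Qed.

Section Closure.
Variable X : set cantor_space.
Implicit Types F G : cantor_space -> nat -> nat.

Lemma computes_code_drop F G : computes X F -> computes X G ->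
  computes X (fun O n => code_drop (F O n) (G O n)).
Proof.
move=> hF hG.
have : computes X (fun O n => iteri (F O n) (fun _ p => p.-1./2) (G O n)).
  by computability.
by apply: computes_ext => O n; elim: (F O n) => //= k ->.
Qed.

Lemma computes_code_nth F G : computes X F -> computes X G ->
  computes X (fun O n => code_nth (F O n) (G O n)).
Proof.
by move=> hF hG; apply: computes_odd; apply: computes_pred; exact: computes_code_drop.
Qed.

Lemma computes_code_size F : computes X F -> computes X (fun O n => code_size (F O n)).
Proof.
move=> hF; apply: (computes_comp (F := F) (G := fun _ n => code_size n)) hF.
apply: computes_sum; first exact: computes_id.
by apply: computes_neg; apply: computes_eq0; apply: computes_code_drop; computability.
Qed.

End Closure.

Ltac computability_hook ::=
  match goal with
  | |- computes _ (fun O n => code_drop (@?F O n) (@?G O n)) =>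
      apply: (computes_code_drop (F := F) (G := G))
  | |- computes _ (fun O n => nat_of_bool (code_nth (@?F O n) (@?G O n))) =>
      apply: (computes_code_nth (F := F) (G := G))
  | |- computes _ (fun O n => code_size (@?F O n)) =>
      apply: (computes_code_size (F := F))
  end.

(* The state is [1] while searching, [0] once [e] was undefined, and [y.+2] once
   the zero [y] was found; predecessor then gives the result in the coding of [ev]. *)
Definition search_step (e : nat -> nat) (j z : nat) : nat :=
  if z == 1 then (if e j == 0 then 0 else if e j == 1 then j.+2 else 1) else z.

Definition search (e : nat -> nat) (k : nat) : nat := (iteri k (search_step e) 1).-1.

(* [q] is a partial oracle and [k] bounds the length of each unbounded search.
   In the values of [q] and [ev], [0] stands for undefined and [y.+1] for [y]. *)
Fixpoint ev (q : nat -> nat) (k : nat) (c : rcode) (n : nat) : nat :=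
  match c with
  | PZero => 1
  | PSucc => n.+2
  | PLeft => (fstn n).+1
  | PRight => (sndn n).+1
  | POracle => q n
  | PPair c1 c2 =>
      if ev q k c1 n is y1.+1 then
        if ev q k c2 n is y2.+1 then (npair y1 y2).+1 else 0
      else 0
  | PComp c1 c2 => if ev q k c2 n is m.+1 then ev q k c1 m else 0
  | PPrec c1 c2 =>
      iteri (sndn n)
        (fun j z => if z is z'.+1 then ev q k c2 (npair (fstn n) (npair j z')) else 0)
        (ev q k c1 (fstn n))
  | PMu c1 => search (fun j => ev q k c1 (npair n j)) k
  end.

(** * Correctness of bounded search and of the evaluator *)

Lemma search_iteri (e : nat -> nat) k :
  match iteri k (search_step e) 1 with
  | 0 => True
  | 1 => forall j, j < k -> exists v, e j = v.+2
  | y.+2 => [/\ y < k, e y = 1 & forall j, j < y -> exists v, e j = v.+2]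
  end.
Proof.
elim: k => [|k IH] //=; case: (iteri k _ 1) IH => [|[|y]] //=; last first.
  by move=> [yk ey hy]; split=> //; exact: ltnW.
rewrite /search_step /= => IH; case E : (e k) => [|[|v]] //= j.
by rewrite ltnS leq_eqVlt => /orP[/eqP ->|/IH//]; exists v.
Qed.

Lemma searchP (e : nat -> nat) k y : search e k = y.+1 <->
  [/\ y < k, e y = 1 & forall j, j < y -> exists v, e j = v.+2].
Proof.
have := search_iteri e k; rewrite /search; split.
  by case: (iteri k _ 1) H => [|[|z]] //= H [<-].
move=> [yk ey hy]; elim: k yk {H} => // k IH; rewrite ltnS leq_eqVlt.
move=> /orP[/eqP yk|yk] /=; last first.
  by move: (IH yk); case: (iteri k _ 1) => [|[|z]].
have -> : iteri k (search_step e) 1 = 1.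
  rewrite -yk; elim: y hy {ey yk IH} => // y IH hy /=.
  rewrite IH; last by move=> j jy; apply: hy; exact: ltnW.
  by have [v] := hy y (ltnSn y); rewrite /search_step => ->.
by rewrite /search_step /= -yk ey.
Qed.

(** Extension of partial functions, with 0 for undefined and [y.+1] for the value [y]. *)
Definition subval (q q' : nat -> nat) := forall n y, q n = y.+1 -> q' n = y.+1.

(** Once a search succeeds, all smaller candidates have defined nonzero values, which persist; hence
    a larger bound finds the same zero. *)
Lemma ev_mono q q' k k' c : subval q q' -> k <= k' -> subval (ev q k c) (ev q' k' c).
Proof.
move=> qq' kk'.
elim: c => [|||||c1 IH1 c2 IH2|c1 IH1 c2 IH2|c1 IH1 c2 IH2|c IH] n y //=.
- exact: qq'.
- case E1 : (ev q k c1 n) => [//|y1]; case E2 : (ev q k c2 n) => [//|y2].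
  by rewrite (IH1 _ _ E1) (IH2 _ _ E2).
- by case E : (ev q k c2 n) => [//|m]; rewrite (IH2 _ _ E); exact: IH1.
- elim: (sndn n) y => [|j IHj] y /=; first exact: IH1.
  case E : (iteri j _ _) => [//|z]; rewrite (IHj _ E); exact: IH2.
- move=> /searchP[yk ey hy]; apply/searchP; split; first exact: leq_trans kk'.
    exact: IH.
  by move=> j /hy [v] /IH ->; exists v.
Qed.

Lemma ev_sound (O : cantor_space) q k c n y : (forall n y, q n = y.+1 -> y = O n) ->
  ev q k c n = y.+1 -> run O c n y.
Proof.
move=> qO.
elim: c n y => [|||||c1 IH1 c2 IH2|c1 IH1 c2 IH2|c1 IH1 c2 IH2|c IH] n y //=;
  try by move=> [<-].
- exact: qO.
- case E1 : (ev q k c1 n) => [//|y1]; case E2 : (ev q k c2 n) => [//|y2] [<-].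
  by exists y1, y2; split=> //; [exact: IH1 | exact: IH2].
- case E : (ev q k c2 n) => [//|m] e1; exists m; [exact: IH2 | exact: IH1].
- rewrite -/(fstn n) -/(sndn n).
  elim: (sndn n) y => [|j IHj] y /=; first exact: IH1.
  case E : (iteri j _ _) => [//|z] e2; exists z; [exact: IHj | exact: IH2].
- move=> /searchP[yk ey hy]; split; first exact: IH.
  by move=> j /hy [v] /IH ?; exists v.
Qed.

(** A halting computation makes finitely many queries and tests finitely many candidates in its
    searches. Each of these is settled at some stage, and by [ev_mono] all are settled at the
    maximum of the stages. *)
Lemma ev_complete (O : cantor_space) (q : nat -> nat -> nat) (k : nat -> nat) c n y :
  (forall s t, s <= t -> subval (q s) (q t)) -> {homo k : s t / s <= t} ->
  (forall n, exists s, q s n = (O n : nat).+1) -> (forall s, s <= k s) ->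
  run O c n y -> exists s, ev (q s) (k s) c n = y.+1.
Proof.
move=> qq kk qO kge.
have up c' n' y' s t : s <= t -> ev (q s) (k s) c' n' = y'.+1 ->
    ev (q t) (k t) c' n' = y'.+1.
  by move=> st; apply: ev_mono; [exact: qq | exact: kk].
elim: c n y => [|||||c1 IH1 c2 IH2|c1 IH1 c2 IH2|c1 IH1 c2 IH2|c IH] n y //=;
  try by move=> ->; exists 0.
- by move=> ->; exact: qO.
- move=> [y1 [y2 [/IH1 [s1 e1] /IH2 [s2 e2] ->]]]; exists (maxn s1 s2).
  by rewrite (up _ _ _ _ _ (leq_maxl _ _) e1) (up _ _ _ _ _ (leq_maxr _ _) e2).
- move=> [m /IH2 [s2 e2] /IH1 [s1 e1]]; exists (maxn s1 s2).
  by rewrite (up _ _ _ _ _ (leq_maxr _ _) e2) (up _ _ _ _ _ (leq_maxl _ _) e1).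
- rewrite -/(fstn n) -/(sndn n) -[X in X -> _]/(primrec _ _ _ _ _).
  suff : forall j y, primrec (run O c1) (run O c2) (fstn n) j y ->
      exists s, ev (q s) (k s) (PPrec c1 c2) (npair (fstn n) j) = y.+1.
    by move=> H /H; rewrite npairK.
  elim=> [|j IHj] {}y /=; rewrite fstn_pair sndn_pair /=; first exact: IH1.
  move=> [z /IHj [s1 e1] /IH2 [s2 e2]]; exists (maxn s1 s2).
  have := up _ _ _ _ _ (leq_maxl s1 s2) e1.
  by rewrite /= fstn_pair sndn_pair => ->; rewrite (up _ _ _ _ _ (leq_maxr _ _) e2).
- move=> [/IH [s0 e0] hy].
  have [s1 hs1] : exists s, forall j, j < y ->
      exists v, ev (q s) (k s) c (npair n j) = v.+2.
    elim: y hy {e0} => [|y IHy] hy; first by exists 0.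
    have [s1 e1] := IHy (fun j jy => hy j (ltnW jy)).
    have [v /IH [s2 e2]] := hy y (ltnSn y).
    exists (maxn s1 s2) => j; rewrite ltnS leq_eqVlt => /orP[/eqP ->|/e1 [u eu]].
      by exists v; apply: up e2; exact: leq_maxr.
    by exists u; apply: up eu; exact: leq_maxl.
  pose t := maxn y.+1 (maxn s0 s1); exists t; apply/searchP; split.
  + by apply: leq_trans (kge t); exact: leq_maxl.
  + by apply: up e0; rewrite /t !leq_max leqnn orbT.
  + by move=> j /hs1 [v e]; exists v; apply: up e; rewrite /t !leq_max leqnn !orbT.
Qed.

(** The induction on [c] takes the place of a universal machine: each fixed program has an evaluator
    built by primitive recursion. [K], [D] and [F] are quantified inside the induction because
    nested calls are made in an enlarged environment. *)
Lemma computes_ev X (Q : cantor_space -> nat -> nat -> nat) c :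
  computes X (fun O e => Q O (fstn e) (sndn e)) ->
  forall K D F, computes X K -> computes X D -> computes X F ->
  computes X (fun O n => ev (Q O (D O n)) (K O n) c (F O n)).
Proof.
move=> hQ.
elim: c => [|||||c1 IH1 c2 IH2|c1 IH1 c2 IH2|c1 IH1 c2 IH2|c IH] K D F hK hD hF /=;
  try by computability.
- exact: (computes2 (H := fun O d n => Q O d n)) hQ hD hF.
- apply: (computes_case (Z := fun O n => ev (Q O (D O n)) (K O n) c1 (F O n))
    (S := fun O n y1 => if ev (Q O (D O n)) (K O n) c2 (F O n) is y2.+1
                        then (npair y1 y2).+1 else 0)).
  + exact: IH1.
  + by computability.
  + apply: (computes_case
      (Z := fun O e => ev (Q O (D O (fstn e))) (K O (fstn e)) c2 (F O (fstn e)))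
      (S := fun O e y2 => (npair (sndn e) y2).+1)); try by computability.
    by apply: IH2; [apply: (computes_comp (G := K)) |
      apply: (computes_comp (G := D)) | apply: (computes_comp (G := F))];
      computability.
- apply: (computes_case (Z := fun O n => ev (Q O (D O n)) (K O n) c2 (F O n))
    (S := fun O n m => ev (Q O (D O n)) (K O n) c1 m)).
  + exact: IH2.
  + by computability.
  + by apply: IH1; [apply: (computes_comp (G := K)) |
      apply: (computes_comp (G := D)) |]; computability.
- apply: (computes_iteri (S := fun O n j z => if z is z'.+1 then
      ev (Q O (D O n)) (K O n) c2 (npair (fstn (F O n)) (npair j z')) else 0)).
  + by computability.
  + by apply: IH1 => //; computability.
  + apply: (computes_case (Z := fun O e => sndn (sndn e))
      (S := fun O e z => ev (Q O (D O (fstn e))) (K O (fstn e)) c2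
        (npair (fstn (F O (fstn e))) (npair (fstn (sndn e)) z))));
      try by computability.
    apply: IH2; [apply: (computes_comp (G := fun O n => K O (fstn n))) |
      apply: (computes_comp (G := fun O n => D O (fstn n))) | ]; try by computability.
    * by apply: (computes_comp (G := K)); computability.
    * by apply: (computes_comp (G := D)); computability.
    * computability.
      by apply: (computes_comp (G := F)); computability.
- pose E O e := ev (Q O (D O (fstn e))) (K O (fstn e)) c
    (npair (F O (fstn e)) (fstn (sndn e))).
  have hE : computes X E.
    by apply: IH; computability; [apply: (computes_comp (G := K)) |
      apply: (computes_comp (G := D)) | apply: (computes_comp (G := F))];
      computability.
  apply: computes_pred.
  apply: (computes_iteri
    (S := fun O n => search_step
      (fun j => ev (Q O (D O n)) (K O n) c (npair (F O n) j)))) => //.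
    by computability.
  apply: (computes_if (Z := fun O e => sndn (sndn e) == 1)); try by computability.
  apply: (computes_if (Z := fun O e => E O e == 0)); try by computability.
  by apply: (computes_if (Z := fun O e => E O e == 1)); computability.
Qed.

(** * Covers by cylinders *)

Section Covers.
Import Order.TTheory GRing.Theory Num.Theory.
Local Open Scope classical_set_scope.
Local Open Scope ring_scope.
Variable R : realType.
Implicit Types (E : set cantor_space) (s t : seq bool) (q : R).

Definition weight (s : seq bool) : R := 2 ^- size s.

Lemma weight_gt0 s : 0 < weight s.
Proof. by rewrite invr_gt0 exprn_gt0. Qed.

Lemma weight_cat s t : weight (s ++ t) = weight s * weight t.
Proof. by rewrite /weight size_cat exprD invfM. Qed.

Lemma weight_rcons s b : weight (rcons s b) = weight s / 2.
Proof. by rewrite -cats1 weight_cat /weight expr1. Qed.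

Lemma sum_half_powers n : \sum_(0 <= k < n) 2 ^- k.+1 <= 1 :> R.
Proof.
suff -> : \sum_(0 <= k < n) 2 ^- k.+1 = 1 - 2 ^- n :> R.
  by rewrite gerBl invr_ge0 exprn_ge0.
elim: n => [|n IH]; first by rewrite big_nil expr0 invr1 subrr.
rewrite big_nat_recr //= IH exprS invfM; lra.
Qed.

Lemma exists_half_power (e : R) : 0 < e -> exists m, 2 ^- m <= e.
Proof.
move=> e0; exists (Num.bound e^-1).
rewrite -[leRHS]invrK lef_pV2 ?posrE ?invr_gt0 ?exprn_gt0 //.
apply: (le_trans (ltW (archi_boundP _))); first by rewrite invr_ge0 ltW.
by rewrite -natrX ler_nat ltnW // ltn_expl.
Qed.

(** This says that the outer measure of [E] is at most [q], as [uniform_mu_leP] shows. Bounding all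
    partial sums keeps the arithmetic in [R]. *)
Definition cov q E := forall e, 0 < e -> exists s : nat -> seq bool,
  E `<=` \bigcup_k cylinder (s k) /\
  forall n, \sum_(0 <= k < n) weight (s k) <= q + e.

Lemma uniform_mu_leP q E : (uniform_mu R E <= q%:E)%E <-> cov q E.
Proof.
split=> [mu_q e e0|covE].
  have : (uniform_mu R E < (q + e)%:E)%E.
    by apply: le_lt_trans mu_q _; rewrite lte_fin ltrDl.
  move=> /ereal_inf_lt[_ [s Es <-] lt_qe]; exists s; split=> // n.
  rewrite -lee_fin; apply: le_trans (ltW lt_qe).
  rewrite -sumEFin; apply: nneseries_lim_ge => k _ _.
  by rewrite lee_fin; exact/ltW/weight_gt0.
apply/lee_addgt0Pr => e /covE[s [Es sum_s]].
apply: (@le_trans _ _ (\sum_(0 <= k <oo) (weight (s k))%:E)%E).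
  by apply: ereal_inf_lbound; exists s.
apply: lime_le.
  by apply: is_cvg_nneseries => k _ _; rewrite lee_fin; exact/ltW/weight_gt0.
by apply: nearW => n; rewrite /= sumEFin -EFinD lee_fin.
Qed.

Lemma cov_le q q' E E' : q <= q' -> E' `<=` E -> cov q E -> cov q' E'.
Proof.
move=> qq' E'E covE e /covE[s [Es sum_s]]; exists s; split.
  exact: subset_trans Es.
by move=> n; apply: le_trans (sum_s n) _; rewrite lerD2r.
Qed.

Lemma cov_eps q E : (forall e, 0 < e -> cov (q + e) E) -> cov q E.
Proof.
move=> covE e e0; have e2 : 0 < e / 2 by rewrite divr_gt0.
have [s [Es sum_s]] := covE _ e2 _ e2; exists s; split=> // n.
by apply: le_trans (sum_s n) _; lra.
Qed.

(** Both components of a pair are at most its code, so the first [n] pairs lie in the square of side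
    [n]. *)
Lemma sum_pair_le (f : nat -> nat -> R) n : (forall k j, 0 <= f k j) ->
  \sum_(0 <= m < n) f (fstn m) (sndn m) <=
  \sum_(0 <= k < n) \sum_(0 <= j < n) f k j.
Proof.
move=> f0; rewrite !big_mkord.
have lt1 (m : 'I_n) : (fstn m < n)%N by exact: leq_ltn_trans (fstn_leq m) _.
have lt2 (m : 'I_n) : (sndn m < n)%N by exact: leq_ltn_trans (sndn_leq m) _.
pose p m := (Ordinal (lt1 m), Ordinal (lt2 m)).
have p_inj : injective p.
  by move=> i j [e1 e2]; apply/val_inj; rewrite -[val i]npairK e1 e2 npairK.
under [leRHS]eq_bigr do rewrite big_mkord.
rewrite pair_big /=.
have <- : \sum_(x in p @: 'I_n) f x.1 x.2 = \sum_(m < n) f (fstn m) (sndn m).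
  by rewrite big_imset //=; exact: in2W.
by rewrite [leRHS](bigID (mem (p @: 'I_n))) /= lerDl sumr_ge0.
Qed.

(** Countable subadditivity: the [k]-th set is covered with error [e * 2 ^- k.+1], and the covers
    are merged along the pairing function. *)
Lemma cov_bigcup (q_ : nat -> R) (E_ : nat -> set cantor_space) q :
  (forall k, cov (q_ k) (E_ k)) -> (forall n, \sum_(0 <= k < n) q_ k <= q) ->
  cov q (\bigcup_k E_ k).
Proof.
move=> covE sum_q e e0.
have ek0 k : 0 < e * 2 ^- k.+1 by rewrite mulr_gt0 // invr_gt0 exprn_gt0.
have /choice[s hs] : forall k, exists s : nat -> seq bool,
    E_ k `<=` \bigcup_j cylinder (s j) /\
    forall n, \sum_(0 <= j < n) weight (s j) <= q_ k + e * 2 ^- k.+1.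
  by move=> k; exact: covE.
exists (fun m => s (fstn m) (sndn m)); split.
  move=> x [k _ /(proj1 (hs k))[j _ xs]].
  by exists (npair k j) => //; rewrite fstn_pair sndn_pair.
move=> n; apply: (@le_trans _ _
    (\sum_(0 <= k < n) \sum_(0 <= j < n) weight (s k j))).
  apply: (@sum_pair_le (fun k j => weight (s k j))) => k j.
  exact/ltW/weight_gt0.
apply: (@le_trans _ _ (\sum_(0 <= k < n) (q_ k + e * 2 ^- k.+1))).
  by apply: ler_sum => k _; exact: (proj2 (hs k)).
rewrite big_split /= lerD //.
by rewrite -mulr_sumr ler_piMr ?sum_half_powers // ltW.
Qed.

(** A cover is an infinite sequence of cylinders, so even the empty set receives strings, here of
    small total weight; they also serve as padding for finite covers. *)
Lemma cov_set0 : cov 0 set0.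
Proof.
move=> e e0; have [m m_e] := exists_half_power e0.
exists (fun k => nseq (m + k.+1) false); split=> // n.
under eq_bigr do rewrite /weight size_nseq exprD invfM.
by rewrite -mulr_sumr add0r; apply: le_trans m_e; rewrite ler_piMr
  ?sum_half_powers // invr_ge0 exprn_ge0.
Qed.

Lemma cov_setU q1 q2 E1 E2 : 0 <= q1 -> 0 <= q2 -> cov q1 E1 -> cov q2 E2 ->
  cov (q1 + q2) (E1 `|` E2).
Proof.
move=> q1_ge0 q2_ge0 cov1 cov2.
pose E_ k := nth set0 [:: E1; E2] k; pose q_ k := nth 0 [:: q1; q2] k.
apply: (@cov_le (q1 + q2) _ (\bigcup_k E_ k)) => //.
  by move=> x [xE|xE]; [exists 0%N | exists 1%N].
apply: (@cov_bigcup q_).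
  move=> [|[|k]]; [exact: cov1 | exact: cov2 |].
  have -> : E_ k.+2 = set0 by case: k.
  have -> : q_ k.+2 = 0 by case: k.
  exact: cov_set0.
have tail n : \sum_(0 <= k < n) q_ k.+2 = 0.
  by rewrite big1 // => k _; rewrite /q_ /= nth_nil.
move=> [|[|n]]; rewrite ?big_nil ?addr_ge0 //.
  by rewrite big_nat1 lerDl.
by rewrite !big_nat_recl //= tail addr0.
Qed.

Lemma cov_cylinder s : cov (weight s) (cylinder s).
Proof.
move=> e /cov_set0[t [_ sum_t]]; exists (fun k => if k is k'.+1 then t k' else s).
split=> [x xs|[|n]]; first by exists 0%N.
  rewrite big_nil addr_ge0 ?(ltW (weight_gt0 _)) //.
  by have := sum_t 0%N; rewrite big_nil add0r.
by rewrite big_nat_recl //= lerD2l; have := sum_t n; rewrite add0r.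
Qed.

Lemma cov_sum (l : seq (seq bool)) (E_ : seq bool -> set cantor_space)
    (q_ : seq bool -> R) :
  (forall s, 0 <= q_ s) -> (forall s, s \in l -> cov (q_ s) (E_ s)) ->
  cov (\sum_(s <- l) q_ s) [set x | exists2 s, s \in l & E_ s x].
Proof.
move=> q0; elim: l => [|s l IH] covE.
  by rewrite big_nil; apply: cov_le cov_set0 => // x [].
rewrite big_cons.
apply: (@cov_le _ _ (E_ s `|` [set x | exists2 s, s \in l & E_ s x])) => //.
  move=> x [t]; rewrite inE => /predU1P[->|tl] xt; [by left | by right; exists t].
apply: cov_setU; rewrite ?sumr_ge0 //.
  by apply: covE; rewrite mem_head.
by apply: IH => t tl; apply: covE; rewrite inE tl orbT.
Qed.

End Covers.

(** * Strings of a given length, concatenation with reals, and cylinders *)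

Fixpoint strings (n : nat) : seq (seq bool) :=
  if n is m.+1 then map (cons false) (strings m) ++ map (cons true) (strings m)
  else [:: [::]].

Lemma mem_strings n s : (s \in strings n) = (size s == n).
Proof.
elim: n s => [|n IH] [|b s] //=; rewrite ?mem_cat; last rewrite eqSS -IH.
  by apply/negbTE; rewrite negb_or; apply/andP; split; apply/mapP => -[].
have mem_cons c : (b :: s \in map (cons c) (strings n)) =
    (b == c) && (s \in strings n).
  apply/mapP/andP => [[t tn [-> ->]]|[/eqP -> sn]]; first by rewrite eqxx.
  by exists s.
by rewrite !mem_cons; case: (b) => //=; rewrite orbF.
Qed.

Lemma prefix_rcons_sum t s : s <> t ->
  prefix (rcons t false) s + prefix (rcons t true) s <= prefix t s.
Proof.
elim: t s => [|c t IH] [|b s] //=; first by rewrite !prefix0s; case: b.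
move=> neq; rewrite /=; case: eqP => //= cb; apply: IH => st.
by apply: neq; rewrite cb st.
Qed.

Definition tail (n : nat) (x : cantor_space) : cantor_space := fun i => x (n + i).

(** Past the end of [t], [nth] returns its default, the shifted bit of [x]. *)
Definition prepend (t : seq bool) (x : cantor_space) : cantor_space :=
  fun i => nth (x (i - size t)) t i.

Lemma prepend_lt t x i : i < size t -> prepend t x i = nth false t i.
Proof. exact: set_nth_default. Qed.

Lemma prepend_ge t x i : size t <= i -> prepend t x i = x (i - size t).
Proof. exact: nth_default. Qed.

Lemma prepend_cat s t x : prepend (s ++ t) x = prepend s (prepend t x).
Proof.
apply/funext => i; have [lt_is|le_si] := ltnP i (size s).
  rewrite (prepend_lt _ lt_is) prepend_lt ?nth_cat ?lt_is //.
  by rewrite size_cat ltn_addr.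
rewrite (prepend_ge _ le_si) /prepend nth_cat ltnNge le_si /= size_cat subnDA.
by [].
Qed.

Lemma cylinderP s (x : cantor_space) :
  cylinder s x <-> forall i, i < size s -> x i = nth false s i.
Proof.
rewrite /cylinder /real_prefix /=; split=> [<- i|xs].
  by rewrite size_mkseq => lt_i; rewrite nth_mkseq.
apply: (@eq_from_nth _ false); rewrite size_mkseq // => i lt_i.
by rewrite nth_mkseq // xs.
Qed.

Lemma cylinder_prefix (x : cantor_space) n : cylinder (mkseq x n) x.
Proof. by rewrite /cylinder /= size_mkseq. Qed.

Lemma prepend_tail t x : cylinder t x -> prepend t (tail (size t) x) = x.
Proof.
move=> /cylinderP xt; apply/funext => i; have [lt_i|le_i] := ltnP i (size t).
  by rewrite prepend_lt // xt.
by rewrite prepend_ge // /tail subnKC.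
Qed.

Lemma cylinder_cat s t x : cylinder s x -> cylinder t (tail (size s) x) ->
  cylinder (s ++ t) x.
Proof.
move=> /cylinderP xs /cylinderP xt; apply/cylinderP => i; rewrite size_cat nth_cat.
case: (ltnP i (size s)) => [lt_i _|le_i lt_i]; first exact: xs.
rewrite -xt ?ltn_subLR //.
by rewrite /tail subnKC.
Qed.

Lemma cylinder_rcons s x : cylinder s x -> cylinder (rcons s (x (size s))) x.
Proof.
move=> xs; rewrite -cats1; apply: cylinder_cat => //.
by rewrite /cylinder /real_prefix /tail /= /mkseq /= addn0.
Qed.

(** * Null sets, constrained bits and open sets *)

Section Covers.
Import Order.TTheory GRing.Theory Num.Theory.
Local Open Scope classical_set_scope.
Local Open Scope ring_scope.
Variable R : realType.
Implicit Types (E G : set cantor_space) (s t : seq bool) (q : R).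

Lemma big_strings_rcons n (F : seq bool -> R) :
  \sum_(s <- strings n.+1) F s =
  \sum_(s <- strings n) (F (rcons s false) + F (rcons s true)).
Proof.
have stringsS m (H : seq bool -> R) : \sum_(s <- strings m.+1) H s =
    \sum_(s <- strings m) H (false :: s) + \sum_(s <- strings m) H (true :: s).
  by rewrite big_cat !big_map.
elim: n F => [|n IH] F; first by rewrite stringsS !big_seq1.
by rewrite [LHS]stringsS [RHS]stringsS !IH.
Qed.

Lemma cov_prepend t q G :
  cov q [set x | G (prepend t x)] -> cov (weight R t * q) (G `&` cylinder t).
Proof.
move=> covG e e0; have [s [Gs sum_s]] := covG e e0.
exists (fun k => t ++ s k); split.
  move=> x [Gx xt]; have [|k _ xk] := Gs (tail (size t) x).
    by rewrite /= prepend_tail.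
  by exists k => //; exact: cylinder_cat.
move=> n; under eq_bigr do rewrite weight_cat.
rewrite -mulr_sumr; apply: (@le_trans _ _ (weight R t * (q + e))).
  by rewrite ler_wpM2l // ltW // weight_gt0.
rewrite mulrDr lerD2l ler_piMl ?(ltW e0) //.
by rewrite invf_le1 ?exprn_gt0 // exprn_ege1 // ler1n.
Qed.

Lemma cov_setT : cov (1 : R) setT.
Proof.
apply: cov_le (@cov_cylinder R [::]) => //.
by rewrite /weight expr0 invr1.
Qed.

(** A form of the Lebesgue density theorem for outer measure. A cover of the part of [G] in a
    cylinder is refined by covering [G] anew inside each of its cylinders, and each round multiplies
    the bound by [3 / 4]. *)
Lemma cov0_density G :
  (forall t, cov (2 / 3 : R) [set x | G (prepend t x)]) -> cov (0 : R) G.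
Proof.
move=> covG.
have covGj j t : cov ((3 / 4) ^+ j : R) [set x | G (prepend t x)].
  elim: j t => [|j IH] t; first by rewrite expr0; apply: cov_le cov_setT.
  (* The error [1 / 12] raises [2 / 3] to [3 / 4]. *)
  have [|s [Gs sum_s]] := covG t (1 / 12); first by rewrite divr_gt0.
  apply: (@cov_le _ _ _ (\bigcup_k ([set x | G (prepend t x)] `&` cylinder (s k)))
    _ (lexx _)).
    by move=> x Gx; have [k _ xk] := Gs x Gx; exists k.
  apply: (@cov_bigcup _ (fun k => weight R (s k) * (3 / 4) ^+ j)).
    move=> k; apply: cov_prepend; apply: cov_le (IH (t ++ s k)) => //.
    by move=> x /=; rewrite prepend_cat.
  move=> n; rewrite -mulr_suml exprS ler_wpM2r ?exprn_ge0 //.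
  by apply: le_trans (sum_s n) _; lra.
apply: cov_eps => e e0; rewrite add0r.
have [m m_e] := exists_half_power e0.
apply: cov_le (covGj (3 * m)%N [::]).
  (* [(3 / 4) ^+ 3] is below one half, so [3 * m] rounds reach [2 ^- m]. *)
  apply: le_trans m_e; rewrite exprM -exprVn lerXn2r ?nnegrE ?exprn_ge0 //.
  by rewrite !exprS expr0; lra.
by move=> x Gx /=; rewrite (_ : prepend _ _ = x) //; apply/funext => i;
  rewrite prepend_ge // subn0.
Qed.

Lemma cov_split s q E : cov q (E `&` cylinder (rcons s false)) ->
  cov q (E `&` cylinder (rcons s true)) -> 0 <= q ->
  cov (q + q) (E `&` cylinder s).
Proof.
move=> cov0 cov1 q0; apply: cov_le (cov_setU q0 q0 cov0 cov1) => // x [Ex xs].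
by move: (cylinder_rcons xs); case: (x (size s)) => xsb; [right|left].
Qed.

(** At a position in [D] only one of the two children of a prefix survives, since [phi] fixes the
    next bit from the earlier ones; at other positions both are kept. Hence every constraint halves
    the bound. *)
Lemma cov_constrained (D : pred nat) (phi : seq bool -> bool) m s :
  cov (weight R s * 2 ^- count D (iota (size s) m))
    [set x | cylinder s x /\ forall n, (size s <= n < size s + m)%N -> D n ->
             x n = phi (mkseq x n)].
Proof.
elim: m s => [|m IH] s.
  by rewrite expr0 invr1 mulr1; apply: cov_le (cov_cylinder s) => // x [].
set E := [set x | _].
have Esub b x : E x -> cylinder (rcons s b) x ->
    [set x | cylinder (rcons s b) x /\
      forall n, (size (rcons s b) <= n < size (rcons s b) + m)%N -> D n ->
        x n = phi (mkseq x n)] x.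
  move=> [xs hx] xsb; split=> // n; rewrite size_rcons addSnnS => /andP[ltn lt_n].
  by apply: hx; rewrite (ltnW ltn).
rewrite /=; case: (boolP (D (size s))) => [Ds|nDs]; rewrite ?add1n ?add0n.
  apply: cov_le (IH (rcons s (phi s))).
    by rewrite weight_rcons size_rcons exprS invfM mulrA.
  move=> x Ex; apply: (Esub) => //; have [xs hx] := Ex.
  have -> : phi s = x (size s).
    rewrite hx ?leqnn ?addnS ?ltnS ?leq_addr //; congr phi.
    by rewrite -[LHS]xs.
  exact: cylinder_rcons.
have -> : weight R s * 2 ^- count D (iota (size s).+1 m) =
    weight R (rcons s false) * 2 ^- count D (iota (size (rcons s false)) m) +
    weight R (rcons s true) * 2 ^- count D (iota (size (rcons s true)) m).
  by rewrite !weight_rcons !size_rcons -mulrDl -splitr.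
have -> : E = E `&` cylinder s.
  by apply/seteqP; split=> [x|x []] // Ex; split=> //; case: Ex.
rewrite !weight_rcons !size_rcons; apply: cov_split.
- apply: cov_le (IH (rcons s false)) => [|x [Ex xsb]]; last exact: Esub Ex xsb.
  by rewrite weight_rcons size_rcons.
- apply: cov_le (IH (rcons s true)) => [|x [Ex xsb]]; last exact: Esub Ex xsb.
  by rewrite weight_rcons size_rcons.
- by rewrite mulr_ge0 ?invr_ge0 ?exprn_ge0 ?divr_ge0 // ltW // weight_gt0.
Qed.

Lemma cov_fixed_bit s j b : (size s <= j)%N ->
  cov (weight R s / 2) [set x | cylinder s x /\ x j = b].
Proof.
move=> le_sj.
have := @cov_constrained (pred1 j) (fun=> b) (j.+1 - size s) s.
rewrite (_ : count _ _ = 1%N).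
  by rewrite expr1; apply: cov_le => // x [xs xj]; split=> // n _ /eqP ->.
rewrite count_uniq_mem ?iota_uniq // mem_iota le_sj subnKC ?ltnSn //.
exact: leq_trans le_sj _.
Qed.

(** The open set is covered by the cylinders of the minimal strings in [P], those selected by [new].
    Since [P] is closed under extension, the minimal strings of length at most [n] have the same
    total weight as the strings of length [n] in [P]. *)
Lemma cov_open (P : pred (seq bool)) q :
  (forall s b, P s -> P (rcons s b)) ->
  (forall n, (count P (strings n))%:R <= q * 2 ^+ n) ->
  cov q [set x : cantor_space | exists n, P (mkseq x n)].
Proof.
move=> Pmono leq_q.
(* [rev (behead (rev s))] is [s] without its last bit. *)
pose new s := P s && ((s == [::]) || ~~ P (rev (behead (rev s)))).
have new_rcons s b : new (rcons s b) = P (rcons s b) && ~~ P s.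
  by rewrite /new rev_rcons /= revK; case: s.
pose q_ n : R := \sum_(s <- strings n) (new s)%:R * 2 ^- n.
have sum_q n : \sum_(0 <= k < n.+1) q_ k = (count P (strings n))%:R * 2 ^- n.
  elim: n => [|n IH].
    by rewrite big_nat1 /q_ /= big_seq1 /new /= andbT addn0.
  rewrite big_nat_recr //= IH /q_ big_strings_rcons -!sum1_count.
  rewrite !natr_sum !(big_mkcond P) /= big_strings_rcons !mulr_suml -big_split /=.
  apply: eq_bigr => s _; rewrite !new_rcons.
  have e2 : 2 ^- n = 2 ^- n.+1 + 2 ^- n.+1 :> R.
    by rewrite exprS invfM; lra.
  have [Ps|_] := boolP (P s); last first.
    by case: (P (rcons s false)); case: (P (rcons s true)); rewrite /=; lra.
  by rewrite !Pmono // !andbF /= !mul0r !addr0 e2 mulrDl !mul1r.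
apply: (@cov_le _ q _ (\bigcup_n [set x | exists2 s, s \in strings n &
    [set x | new s /\ cylinder s x] x])) => //.
  move=> x [n Pn]; elim: n Pn => [|n IH] Pn.
    exists 0%N => //; exists [::]; rewrite ?mem_strings //=; split=> //.
    by rewrite /new Pn.
  have [/IH //|nP] := boolP (P (mkseq x n)).
  exists n.+1 => //; exists (mkseq x n.+1); first by rewrite mem_strings size_mkseq.
  split; last exact: cylinder_prefix.
  by move: Pn; rewrite mkseqS new_rcons nP => ->.
apply: (@cov_bigcup _ q_) => n.
  apply: cov_sum => s; first by rewrite mulr_ge0 ?invr_ge0 ?exprn_ge0.
  rewrite mem_strings => /eqP size_s; case: (boolP (new s)) => [ns|nns].
    by rewrite mul1r -size_s; apply: cov_le (cov_cylinder s) => // x [].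
  by rewrite mul0r; apply: cov_le (@cov_set0 R) => // x [].
case: n => [|n]; last by rewrite sum_q ler_pdivrMr ?exprn_gt0.
rewrite big_nil; have := leq_q 0%N; rewrite expr0 mulr1; apply: le_trans.
by rewrite ler0n.
Qed.

Lemma uniform_mu_setT_gt0 : (0 < uniform_mu R setT)%E.
Proof.
rewrite ltNge; apply/negP => /uniform_mu_leP /(_ (1 / 4)) [|s [setTs sum_s]].
  by rewrite divr_gt0.
(* If the [s k] have total weight at most 1/4, some branch [x] has, at each of its
   prefixes [t], at most half of the weight of [t] on the [s k] extending [t]; so
   no [s k] is a prefix of [x]. *)
pose mass t n := \sum_(0 <= k < n) (prefix t (s k))%:R * weight R (s k).
pose light t := forall n, mass t n <= weight R t / 2.
have mass_mono t : {homo mass t : m n / (m <= n)%N >-> m <= n}.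
  apply: homo_leq => [//|u v w|n]; first exact: le_trans.
  by rewrite /mass big_nat_recr //= lerDl mulr_ge0 // ltW // weight_gt0.
have light_neq t k : light t -> s k <> t.
  move=> /(_ k.+1); rewrite /mass big_nat_recr //= => le_k skt.
  move: le_k; rewrite skt prefix_refl mul1r; apply/negP; rewrite -ltNge.
  apply: (@lt_le_trans _ _ (weight R t)).
    by have := weight_gt0 R t; lra.
  by rewrite lerDr sumr_ge0 // => i _; rewrite mulr_ge0 // ltW // weight_gt0.
have step t : light t -> exists b, light (rcons t b).
  move=> lt_t; apply/not_existsP => nlight.
  have heavy b : exists n, weight R (rcons t b) / 2 < mass (rcons t b) n.
    apply/not_existsP => h; apply: (nlight b) => n.
    by rewrite leNgt; apply/negP; exact: h.
  have [n0 h0] := heavy false; have [n1 h1] := heavy true.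
  have := lt_t (maxn n0 n1).
  have : mass (rcons t false) (maxn n0 n1) + mass (rcons t true) (maxn n0 n1) <=
      mass t (maxn n0 n1).
    rewrite /mass -big_split /=; apply: ler_sum => k _.
    rewrite -mulrDl ler_wpM2r ?(ltW (weight_gt0 _ _)) // -natrD ler_nat.
    by rewrite prefix_rcons_sum //; exact: light_neq lt_t.
  have := mass_mono (rcons t false) _ _ (leq_maxl n0 n1).
  have := mass_mono (rcons t true) _ _ (leq_maxr n0 n1).
  move: h0 h1; rewrite !weight_rcons. lra.
have [next hnext] : exists next : seq bool -> bool,
    forall t, light t -> light (rcons t (next t)).
  have /choice[next hnext] : forall t, exists b, light t -> light (rcons t b).
    move=> t; have [/step[b lb]|nlt] := pselect (light t); first by exists b.
    by exists true => /nlt.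
  by exists next.
pose pre := fix pre n := if n is m.+1 then rcons (pre m) (next (pre m)) else [::].
have light_pre n : light (pre n).
  elim: n => [n|n IH]; last exact: hnext.
  rewrite /weight /= expr0 invr1; apply: (@le_trans _ _ (1 / 4)); last by lra.
  have := sum_s n; rewrite add0r; apply: le_trans; apply: ler_sum => k _.
  by rewrite prefix0s mul1r.
pose x : cantor_space := fun n => next (pre n).
have preE n : mkseq x n = pre n by elim: n => // n IH; rewrite mkseqS IH.
have [k _ xk] := setTs x I.
by apply: (light_neq _ k (light_pre (size (s k)))); rewrite -preE -[LHS]xk.
Qed.

End Covers.

(** * Shuffles *)

Section Shuffle.
Variables (A : set nat) (h : seq bool -> option bool) (a : nat -> nat).
Hypotheses (hashA : is_hash A h) (enumA : computable_enumeration A a).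

Local Notation f := (shuffle a h).

Let a_inj : injective a. Proof. by case: enumA. Qed.
Let a_in i : A (a i). Proof. by case: enumA => _ _ <-; exists i. Qed.

(** The input real is taken from a family indexed by numbers: the lemma is applied to the oracle
    itself and to the reals [code_nth p], which extend finite strings by zeros. *)
Lemma computes_shuffle X (V : cantor_space -> nat -> cantor_space) :
  computes X (fun O e => V O (fstn e) (sndn e)) ->
  computes X (fun O e => f (V O (fstn e)) (sndn e)).
Proof.
move=> hV; have [comp_a _ _] := enumA; have [[c hc] hdom] := hashA.
have ha : computes X (fun _ e => a (sndn e)).
  by apply: (computes_fun (F := fun _ e => sndn e)) => //; computability.
apply: (computes_addb (Y := fun O e => V O (fstn e) (a (sndn e)))
  (Z := fun O e => odflt false (h (real_prefix (V O (fstn e)) (a (sndn e)))))).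
  by apply: (computes2 (H := fun O d n => V O d n)) => //; computability.
apply: (@computes_run X c
  (fun O e => string_code (real_prefix (V O (fstn e)) (a (sndn e))))).
  move=> O e _; apply/hc; set s := real_prefix _ _.
  have : h s != None by apply/hdom; rewrite size_mkseq.
  by case: (h s).
have : computes X (fun O e => \sum_(0 <= j < a (sndn e)) (V O (fstn e) j).+1 * 2 ^ j).
  computability.
  by apply: (computes2 (H := fun O d n => V O d n)) => //; computability.
by apply: computes_ext => O e; rewrite string_code_mkseq.
Qed.

Lemma shuffle_total_computable : total_computable (as_partial f).
Proof.
split; last by apply/seteqP; split=> // x _; rewrite /pdom /as_partial /=.
have [c hc] : computes setT (fun O n => f O n).
  have : computes setT (fun O e => f O (sndn e)).
    by apply: (computes_shuffle (V := fun O _ => O)); computability.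
  move=> /(fun H => computes2 (H := fun O _ n => f O n) H (computes_const _ 0)
    (computes_id _)).
  exact.
exists c => x z; rewrite /as_partial; split=> [[<-] n|hz]; first exact: hc.
congr Some; apply/funext => n; have := run_det (hc x n I) (hz n).
by case: (f x n); case: (z n).
Qed.

Lemma shuffle_eq_prefix (x x' : cantor_space) i :
  (forall j, j <= a i -> x j = x' j) -> f x i = f x' i.
Proof.
move=> xx'; rewrite /shuffle xx' //; congr (_ (+) odflt _ (h _)).
apply: (@eq_from_nth _ false); rewrite !size_mkseq // => j lt_j.
by rewrite !nth_mkseq // xx' // ltnW.
Qed.

(** * Measure and randomness under the shuffle *)

Section Measure.
Import Order.TTheory GRing.Theory Num.Theory.
Local Open Scope classical_set_scope.
Variable R : realType.

(** When output bit [i] is prescribed, the equation defining the shuffle can be solved for [x (a i)]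
    in terms of the earlier bits. As [a] is injective, the cylinder of [s] imposes exactly [size s]
    constraints of the kind treated in [cov_constrained]. *)
Lemma cov_shuffle_cylinder s : cov (weight R s) (f @^-1` cylinder s).
Proof.
pose l := map a (iota 0 (size s)); pose m := (\max_(n <- l) n).+1.
pose phi t := nth false s (index (size t) l) (+) odflt false (h t).
have count_l : count (mem l) (iota 0 m) = size s.
  rewrite -size_filter -[RHS](size_iota 0) -(size_map a).
  apply/perm_size/uniq_perm; rewrite ?filter_uniq ?iota_uniq //.
    by rewrite map_inj_uniq ?iota_uniq.
  move=> n; rewrite mem_filter mem_iota /= add0n ltnS andb_idr // => nl.
  exact: leq_bigmax_seq.
have := @cov_constrained R (mem l) phi m [::].
rewrite [X in (_ * _ ^- X)%R](_ : _ = size s) //.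
rewrite {1}/weight expr0 invr1 mul1r.
apply: cov_le; rewrite ?lexx // => x /cylinderP xs; split=> // n _ nl.
have lt_j : (index n l < size s)%N.
  by move: (nl : n \in l); rewrite -index_mem size_map size_iota.
have aj : a (index n l) = n.
  have := nth_index 0 nl; rewrite (nth_map 0) ?size_iota // nth_iota //.
have := xs _ lt_j; rewrite /shuffle aj /phi size_mkseq => <-.
by rewrite -addbA addbb addbF.
Qed.

Lemma cov_shuffle q E : cov (q : R) E -> cov q (f @^-1` E).
Proof.
move=> covE; apply: cov_eps => e e0; have [s [Es sum_s]] := covE e e0.
apply: (@cov_le _ _ _ (\bigcup_k (f @^-1` cylinder (s k))) _ (lexx _)).
  by move=> x Ex; have [k _ xk] := Es _ Ex; exists k.
by apply: cov_bigcup sum_s => k; exact: cov_shuffle_cylinder.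
Qed.

Lemma shuffle_ml_test U : ml_test R U -> ml_test R (fun n => f @^-1` U n).
Proof.
move=> [[c hc] mu_U]; split; last first.
  by move=> n; apply/uniform_mu_leP/cov_shuffle/uniform_mu_leP.
pose X := [set zero_real].
pose fp p : cantor_space := f (code_nth p).
have hfp : computes X (fun _ e => fp (fstn e) (sndn e)).
  by apply: (computes_shuffle (V := fun _ p => code_nth p)); computability.
have ha : computes X (fun _ e => a e).
  by apply: (computes_fun (F := fun _ e => e)); [case: enumA | computability].
(* The length of a string encodes a number [k] of output bits: the string is put
   in the new test when it determines the first [k] bits of the shuffle and these
   form a string of the given test.  So no dovetailing over [k] is needed. *)
pose K e := fstn (code_size (sndn e)).
pose bad e := (\sum_(0 <= i < K e) (code_drop (a i) (sndn e) == 0))%N.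
pose val e := npair (fstn e) (string_code (mkseq (fp (sndn e)) (K e))).
have [cb hcb] : computes X (fun _ e => bad (fstn e)).
  rewrite /bad /K; computability.
  by apply: (computes_comp (G := fun _ e => a e)); computability.
have [cv hcv] : computes X (fun _ e => val e).
  have : computes X (fun _ e =>
      npair (fstn e) (\sum_(0 <= j < K e) (fp (sndn e) j).+1 * 2 ^ j)%N).
    rewrite /K; computability.
    by apply: (computes2 (H := fun _ d n => fp d n)) => //; computability.
  by apply: computes_ext => O e; rewrite -string_code_mkseq.
(* [cb] ignores the search variable, so [PMu cb] halts exactly when [bad] vanishes. It acts as a
   guard, and [PRight] discards its result before [c] is run. *)
exists (PComp c (PComp PRight (PPair (PMu cb) cv))) => n.
have runE s y : run zero_real (PComp c (PComp PRight (PPair (PMu cb) cv)))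
      (npair n (string_code s)) y <->
    (forall i, i < fstn (size s) -> a i < size s) /\
    run zero_real c
      (npair n (string_code (mkseq (fp (string_code s)) (fstn (size s))))) y.
  set e := npair n _.
  have valE : val e =
      npair n (string_code (mkseq (fp (string_code s)) (fstn (size s)))).
    by rewrite /val /K /e fstn_pair sndn_pair code_sizeE.
  have bad0 : bad e = 0 <-> forall i, i < fstn (size s) -> a i < size s.
    rewrite /bad /K /e sndn_pair code_sizeE big_mkord; split.
      move=> /eqP; rewrite sum_nat_eq0 => /forallP ok i lt_i.
      have := ok (Ordinal lt_i); rewrite /= code_drop_eq0.
      by rewrite ltnNge; case: leq.
    move=> ok; apply: big1 => i _; rewrite code_drop_eq0.
    by have := ok _ (ltn_ord i); rewrite ltnNge => /negbTE ->.
  have hb k : run zero_real cb (npair e k) (bad e).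
    by have := hcb zero_real (npair e k) erefl; rewrite fstn_pair.
  have hv : run zero_real cv e (val e) by exact: hcv.
  split=> /=.
    move=> [m [p [y1 [y2 [[r0 _] r2 ->]] ->]]]; rewrite -/(sndn _) sndn_pair.
    rewrite -valE -(run_det hv r2) => ry; split=> //; apply/bad0.
    exact: run_det (hb _) r0.
  move=> [/bad0 b0 ry]; exists (val e); last by rewrite valE.
  exists (npair 0 (val e)); last by rewrite -/(sndn _) sndn_pair.
  by exists 0, (val e); split=> //; split=> //; rewrite -b0.
have fE s x i : cylinder s x -> a i < size s -> f x i = fp (string_code s) i.
  move=> /cylinderP xs lt_ai; apply: shuffle_eq_prefix => j le_j.
  by rewrite code_nthE xs // (leq_ltn_trans le_j).
have prefE s x : cylinder s x -> (forall i, i < fstn (size s) -> a i < size s) ->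
    mkseq (fp (string_code s)) (fstn (size s)) = mkseq (f x) (fstn (size s)).
  move=> xs ok; apply: (@eq_from_nth _ false); rewrite !size_mkseq // => i lt_i.
  by rewrite !nth_mkseq // -(fE _ _ _ xs) // ok.
rewrite hc; apply/seteqP; split=> x /=.
  move=> [t [y ry]] fxt; pose k := size t.
  (* The pairing gives a length whose first component is [k] and which exceeds all positions [a i]
     with [i < k]. *)
  pose N := npair k (\max_(i < k) a i).+1.
  have ok i : i < fstn N -> a i < N.
    rewrite fstn_pair => lt_i; apply: leq_trans (leq_npair _ _).
    rewrite addnS ltnS; apply: leq_trans (leq_addl _ _).
    exact: (leq_bigmax (Ordinal lt_i)).
  exists (mkseq x N); last exact: cylinder_prefix.
  exists y; apply/runE; rewrite size_mkseq; split=> //.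
  have := prefE (mkseq x N) x (cylinder_prefix x N); rewrite size_mkseq => -> //.
  by rewrite fstn_pair (_ : mkseq _ k = t).
move=> [s [y /runE[ok ry]] xs]; exists (mkseq (f x) (fstn (size s))).
  by exists y; rewrite -prefE.
exact: cylinder_prefix.
Qed.

Lemma shuffle_random_preserving : random_preserving R (as_partial f).
Proof.
split; first by rewrite (proj2 shuffle_total_computable) uniform_mu_setT_gt0.
move=> x _ [<-] rx U /shuffle_ml_test/rx nU fxU; apply: nU => n _.
exact: fxU.
Qed.

End Measure.
End Shuffle.

(** * Surjectivity and uncountable fibres *)

Lemma computes_eventually_const X (g : nat -> nat) k N :
  (forall n, N <= n -> g n = k) -> computes X (fun _ n => g n).
Proof.
elim: N g => [|N IH] g gk.
  by apply: computes_ext (computes_const X k) => O n; rewrite gk.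
have hS : computes X (fun _ n => g (sndn n).+1).
  apply: (computes_comp (G := fun _ n => g n.+1)); last by computability.
  by apply: IH => n le_n; exact: gk.
have := computes_case (S := fun _ _ z => g z.+1)
  (computes_id X) (computes_const X (g 0)) hS.
by apply: computes_ext => O [].
Qed.

Section Fibers.
Local Open Scope classical_set_scope.
Variables (A : set nat) (h : seq bool -> option bool) (a : nat -> nat).
Hypotheses (ncA : ~ computable_set A) (enumA : computable_enumeration A a).

Lemma noncomputable_co_infinite :
  exists p : nat -> nat, injective p /\ forall k, ~ A (p k).
Proof.
have unbounded N : exists n, N <= n /\ ~ A n.
  apply: contrapT => bounded; apply: ncA.
  have [|c hc] := @computes_eventually_const [set zero_real]
    (fun n => char_real A n) 1 N; last by exists c => n; exact: (hc zero_real).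
  move=> n le_n; rewrite /char_real mem_set //.
  by apply: contrapT => nAn; apply: bounded; exists n.
have /choice[next hnext] := unbounded.
pose p := fix p k := if k is j.+1 then next (p j).+1 else next 0.
exists p; split; last by case=> [|k]; [case: (hnext 0) | case: (hnext (p k).+1)].
have p_incr : {homo p : i j / i < j}.
  apply: homo_ltn => [j i k|k]; first exact: ltn_trans.
  by case: (hnext (p k).+1).
by move=> i j pij; case: (ltngtP i j) => // /p_incr; rewrite pij ltnn.
Qed.

(** The preimage is built by recursion on its prefixes. At a position [a i] the bit is solved from
    [y i] and the hash of the prefix already built; elsewhere it is copied from [u]. The freedom of
    [u] allows diagonalization against a countable fibre. *)
Lemma shuffle_preimage (u : nat -> bool) y :
  exists2 x, shuffle a h x = y & forall n, ~ A n -> x n = u n.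
Proof.
have [_ a_inj aA] := enumA.
pose bit t := if pselect (exists i, a i = size t) is left e
  then y (projT1 (cid e)) (+) odflt false (h t) else u (size t).
pose pre := fix pre n := if n is m.+1 then rcons (pre m) (bit (pre m)) else [::].
pose x : cantor_space := fun n => bit (pre n).
have preE n : mkseq x n = pre n by elim: n => // n IH; rewrite mkseqS IH.
have size_pre n : size (pre n) = n by rewrite -preE size_mkseq.
exists x.
  apply/funext => i; rewrite /shuffle /real_prefix preE /x /bit.
  case: pselect => [e|[]]; last by exists i; rewrite size_pre.
  case: cid => j /=; rewrite size_pre => /a_inj ->.
  by rewrite -addbA addbb addbF.
move=> n nAn; rewrite /x /bit; case: pselect => [[i]|_]; last by rewrite size_pre.
by rewrite size_pre => ai; case: nAn; rewrite -aA; exists i.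
Qed.

Lemma shuffle_surjective : real_surjective (shuffle a h).
Proof. by move=> y; have [x] := shuffle_preimage xpred0 y; exists x. Qed.

Lemma shuffle_nowhere_injective : nowhere_injective (shuffle a h).
Proof.
move=> y /countable_injP[e e_inj].
have [p [p_inj pA]] := noncomputable_co_infinite.
pose B := shuffle a h @^-1` [set y].
(* The free bit [p k] is chosen to differ from that of the [k]-th preimage. *)
have [x fx xu] := shuffle_preimage
  (fun n => ~~ `[< exists x, [/\ B x, p (e x) = n & x n] >]) y.
have Bx : x \in B by apply/mem_set.
have := xu _ (pA (e x)); case: asboolP => /= [[x' [Bx' /p_inj ex' x'n]]|nex] xn.
  have xx' : x' = x by apply: e_inj ex' => //; exact/mem_set.
  by move: xn; rewrite -{1}xx' x'n.
by apply: nex; exists x.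
Qed.

End Fibers.

(** * Inversion *)

Lemma size_strings n : size (strings n) = 2 ^ n.
Proof. by elim: n => // n IH; rewrite size_cat !size_map IH addnn -mul2n expnS. Qed.

(** The codes of the strings of length [n] form the interval of [2 ^ n] numbers that starts at
    [(2 ^ n).-1], so counting strings becomes a computable bounded sum. *)
Lemma sum_strings (F : nat -> nat) n :
  \sum_(0 <= m < 2 ^ n) F ((2 ^ n).-1 + m) = \sum_(s <- strings n) F (string_code s).
Proof.
have sum_double K (H : nat -> nat) :
    \sum_(0 <= m < K.*2) H m = \sum_(0 <= m < K) H m.*2 + \sum_(0 <= m < K) H m.*2.+1.
  elim: K => [|K IH]; first by rewrite !big_nil.
  by rewrite doubleS !big_nat_recr //= IH -!addnA; congr addn; rewrite addnCA.
elim: n F => [|n IH] F; first by rewrite big_nat1 big_seq1.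
have pow_pred : (2 ^ n).*2.-1 = (2 ^ n).-1.*2.+1.
  by case: (2 ^ n) (expn_gt0 2 n).
rewrite big_cat !big_map expnS mul2n sum_double pow_pred; congr addn.
  transitivity (\sum_(s <- strings n) (fun m => F m.*2.+1) (string_code s)).
    by rewrite -(IH (fun m => F m.*2.+1)); apply: eq_bigr => m _; rewrite addSn doubleD.
  by apply: eq_bigr => s _; rewrite string_code_cons addn0.
transitivity (\sum_(s <- strings n) (fun m => F m.*2.+2) (string_code s)).
  by rewrite -(IH (fun m => F m.*2.+2)); apply: eq_bigr => m _;
      rewrite addSn addnS doubleD.
by apply: eq_bigr => s _; rewrite string_code_cons addn1.
Qed.

(** Queries to [w] are always answered; queries to the other half are answered from the string coded
    by [p] and are undefined beyond its end. *)
Definition partial_join (w : cantor_space) (p q : nat) : nat :=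
  if odd q then (w q./2).+1
  else if code_drop q./2 p == 0 then 0 else (code_nth p q./2).+1.

(* The code [p] of the known prefix also serves as the search bound: it increases
   with the prefix and exceeds its length. *)
Definition converges (w : cantor_space) (c : rcode) (p n : nat) : bool :=
  \sum_(0 <= j < n.+1) (ev (partial_join w p) p c j == 0) == 0.

(** The value 2 of [ev] stands for the output 1; undefined bits become 0. *)
Definition output (w : cantor_space) (c : rcode) (p : nat) : cantor_space :=
  fun j => ev (partial_join w p) p c j == 2.

Lemma convergesP w c p n : reflect
  (forall j, j <= n -> ev (partial_join w p) p c j <> 0) (converges w c p n).
Proof.
rewrite /converges big_mkord sum_nat_eq0; apply: (iffP forallP) => ok.
  move=> j le_j; have := ok (Ordinal (le_j : j < n.+1)).
  by rewrite /= eqb0 => /eqP.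
by move=> j; rewrite /= eqb0; apply/eqP/ok; rewrite -ltnS.
Qed.

Lemma partial_join_sound w s v : cylinder s v ->
  forall q b, partial_join w (string_code s) q = b.+1 -> b = real_join v w q.
Proof.
move=> /cylinderP sv q b; rewrite /partial_join /real_join code_drop_eq0 code_nthE.
by case: odd => [[<-]//|]; case: leqP => // lt_q [<-]; rewrite sv.
Qed.

Lemma partial_join_mono w s t :
  subval (partial_join w (string_code s)) (partial_join w (string_code (s ++ t))).
Proof.
move=> q b; rewrite /partial_join !code_drop_eq0 !code_nthE size_cat nth_cat.
case: odd => //; case: ltnP => // lt_q.
by rewrite leqNgt ltn_addr.
Qed.

Lemma partial_join_complete w v q :
  exists k, partial_join w (string_code (mkseq v k)) q = (real_join v w q : nat).+1.
Proof.
exists q.+1; rewrite /partial_join /real_join; case: odd => //.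
have lt_q : q./2 < q.+1 by rewrite ltnS -{2}[q]odd_double_half -addnn addnA leq_addl.
by rewrite code_drop_eq0 code_nthE size_mkseq leqNgt lt_q /= nth_mkseq.
Qed.

Lemma string_code_cat_leq s t : string_code s <= string_code (s ++ t).
Proof. by rewrite string_code_cat leq_addr. Qed.

Lemma mkseq_prefix (v : cantor_space) k l : k <= l ->
  exists t, mkseq v l = mkseq v k ++ t.
Proof. by move=> /subnKC <-; rewrite {1}/mkseq iotaD map_cat; eexists. Qed.

Lemma converges_cat w c s t n : converges w c (string_code s) n ->
  converges w c (string_code (s ++ t)) n.
Proof.
move=> /convergesP ok; apply/convergesP => j /ok.
case E : (ev _ _ _ _) => [|y] // _.
by rewrite (ev_mono (@partial_join_mono w s t) (string_code_cat_leq s t) E).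
Qed.

Lemma output_correct w c s v z n : cylinder s v -> outputs_real (real_join v w) c z ->
  converges w c (string_code s) n ->
  forall j, j <= n -> output w c (string_code s) j = z j.
Proof.
move=> sv vz /convergesP ok j /ok; rewrite /output.
case E : (ev _ _ _ _) => [|y] // _.
rewrite (run_det (ev_sound (partial_join_sound sv) E) (vz j)).
by case: (z j).
Qed.

(** The prefixes of [v], with their codes as search bounds, are the stages of [ev_complete]. The
    induction provides a prefix that settles the bits below [n]; the longer of it and a prefix that
    settles bit [n] serves for all. *)
Lemma converges_complete w c v z n : outputs_real (real_join v w) c z ->
  exists k, converges w c (string_code (mkseq v k)) n.
Proof.
move=> vz; elim: n.+1 {-2}n (leqnn n.+1) => // m IH {}n.
rewrite ltnS => le_nm.
have [k0 hk0] : exists k, forall j, j < n -> ev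
    (partial_join w (string_code (mkseq v k))) (string_code (mkseq v k)) c j <> 0.
  case: n le_nm => [_|n /IH[k /convergesP hk]]; first by exists 0.
  by exists k => j; exact: hk.
have mono k l : k <= l -> string_code (mkseq v k) <= string_code (mkseq v l).
  by move=> /(mkseq_prefix v)[t ->]; exact: string_code_cat_leq.
have qmono k l : k <= l -> subval (partial_join w (string_code (mkseq v k)))
    (partial_join w (string_code (mkseq v l))).
  by move=> /(mkseq_prefix v)[t ->]; exact: partial_join_mono.
have [k1 ek1] := ev_complete qmono mono (partial_join_complete w v)
  (fun k => leq_trans (eq_leq (esym (size_mkseq v k)))
                      (size_leq_string_code (mkseq v k))) (vz n).
exists (maxn k0 k1); apply/convergesP => j.
rewrite leq_eqVlt => /predU1P[->|/hk0].
  by rewrite (ev_mono (qmono _ _ (leq_maxr k0 k1)) (mono _ _ (leq_maxr k0 k1)) ek1).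
case E : (ev _ _ _ _) => [|y] // _.
by rewrite (ev_mono (qmono _ _ (leq_maxl k0 k1)) (mono _ _ (leq_maxl k0 k1)) E).
Qed.

Lemma computes_converges X c D F : computes X D -> computes X F ->
  computes X (fun O n => converges O c (D O n) (F O n)).
Proof.
apply: (computes2 (H := fun O p n => converges O c p n)).
apply: computes_eq0; computability.
apply: (@computes_ev X partial_join c _ (fun _ e => fstn (fstn e))
  (fun _ e => fstn (fstn e)) (fun _ e => sndn e)); try by computability.
apply: (computes_if (Z := fun _ e => odd (sndn e))); try by computability.
by apply: (computes_if (Z := fun _ e => code_drop (sndn e)./2 (fstn e) == 0));
  computability.
Qed.

(** * Success sets of inverting machines *)

Section Inversion.
Import Order.TTheory GRing.Theory Num.Theory.
Local Open Scope classical_set_scope.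
Variables (R : realType) (A : set nat) (h : seq bool -> option bool) (a : nat -> nat).
Hypothesis (enumA : computable_enumeration A a).
Variables (w : cantor_space) (c : rcode) (G : set cantor_space).
Hypothesis G_inv : forall v, G v -> exists2 z, outputs_real (real_join v w) c z &
  forall i, v i.*2 = shuffle a h z i.

Variable t : seq bool.

Let conv n s := converges w c (string_code (t ++ s)) n.
(** The fraction [2 / 3] is written as a strict inequality of naturals so that a stage can be found
    by search. *)
Let many n k := (2 * 2 ^ k < 3 * count (conv n) (strings k))%N.

(** Every point of [G] has a prefix at which the bits up to [n] have converged, and convergence
    persists under extension. The points with such a prefix form an open set, to which [cov_open]
    applies with density at most [2 / 3] at each level. *)
Lemma cov_few_converge n :
  (forall k, ~~ many n k) -> cov (2 / 3 : R)%R [set x | G (prepend t x)].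
Proof.
move=> few; apply: (@cov_le _ (2 / 3)%R _ [set x | exists k, conv n (mkseq x k)]).
- exact: lexx.
- move=> x /G_inv[z vz _]; have [k hk] := converges_complete n vz.
  exists k; rewrite /conv.
  have -> : t ++ mkseq x k = mkseq (prepend t x) (size t + k).
    apply: (@eq_from_nth _ false); rewrite size_cat !size_mkseq // => i lt_i.
    rewrite nth_mkseq // nth_cat; have [lt_it|le_ti] := ltnP i (size t).
      by rewrite prepend_lt.
    by rewrite prepend_ge // nth_mkseq // ltn_subLR.
  have [s ->] := mkseq_prefix (prepend t x) (leq_addl (size t) k).
  exact: converges_cat.
apply: cov_open => [s b|k].
  by rewrite /conv -cats1 catA; exact: converges_cat.
rewrite -natrX mulrAC ler_pdivlMr // -!natrM ler_nat mulnC.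
by rewrite leqNgt; exact: few.
Qed.

(** The bit [i.*2] lies beyond both [t] and the [k] further bits, so on a converged string the
    prediction [bit s] is a constant that half of the cylinder contradicts. More than [2 / 3] of the
    strings converge, so more than [1 / 3] is lost. *)
Lemma cov_many_converge i k :
  many (a i) k -> (size t + k <= i.*2)%N ->
  cov (2 / 3 : R)%R [set x | G (prepend t x)].
Proof.
move=> many_k le_i; pose bit s := shuffle a h (output w c (string_code (t ++ s))) i.
pose E s : set cantor_space :=
  [set x | cylinder s x /\ (conv (a i) s -> x (i.*2 - size t)%N = bit s)].
pose q s : R := ((if conv (a i) s then 2^-1 else 1) * 2 ^- k)%R.
apply: (@cov_le _ (\sum_(s <- strings k) q s)%R _
    [set x | exists2 s, s \in strings k & E s x]).
- have := many_k; rewrite /many -(ltr_nat R) !natrM natrX /q -mulr_suml.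
  rewrite ler_pdivrMr ?exprn_gt0 // -sum1_count natr_sum.
  have -> : (\sum_(s <- strings k) (if conv (a i) s then 2^-1 else 1) =
      2 ^+ k - (\sum_(s <- strings k | conv (a i) s) 1) / 2 :> R)%R.
    rewrite [in RHS]big_mkcond mulr_suml -natrX -size_strings -sum1_size natr_sum.
    rewrite -sumrB; apply: eq_bigr => s _; case: ifP => _; lra.
  lra.
- move=> x /G_inv[z vz fz]; exists (mkseq x k); first by rewrite mem_strings size_mkseq.
  split=> [|conv_x]; first exact: cylinder_prefix.
  rewrite -(@prepend_ge t); last exact: leq_trans (leq_addr _ _) le_i.
  (* Bit [i] of the shuffle depends on its argument only up to [a i], which is why convergence is
     asked up to [a i]. *)
  rewrite fz; apply/esym/shuffle_eq_prefix.
  apply: output_correct vz conv_x; apply: cylinder_cat.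
    by apply/cylinderP => j lt_j; rewrite prepend_lt.
  have -> : tail (size t) (prepend t x) = x.
    by apply/funext => j; rewrite /tail prepend_ge ?leq_addr // addKn.
  exact: cylinder_prefix.
apply: cov_sum => s.
  by rewrite /q; case: ifP => _; rewrite ?mul1r ?mulr_ge0 ?invr_ge0 ?exprn_ge0.
rewrite mem_strings => /eqP size_s; rewrite /q /E -size_s; case: ifP => conv_s.
  have := @cov_fixed_bit R s (i.*2 - size t)%N (bit s).
  rewrite size_s leq_subRL ?(leq_trans (leq_addr _ _) le_i) // => /(_ le_i).
  rewrite mulrC /weight size_s; apply: cov_le => // x [xs xj]; split=> //.
  exact: xj.
by rewrite mul1r; apply: cov_le (cov_cylinder s) => // x [].
Qed.

Hypothesis nTA : ~ turing_le (char_real A) w.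

Lemma cov_inversion : cov (2 / 3 : R)%R [set x | G (prepend t x)].
Proof.
have [[n few]|nfew] := pselect (exists n, forall k, ~~ many n k).
  exact: cov_few_converge few.
have [[i [k mk le_i]]|nmany] := pselect (exists i, exists2 k,
    many (a i) k & (size t + k <= i.*2)%N).
  exact: cov_many_converge mk le_i.
have exmany n : exists k, many n k.
  by apply: contrapT => nm; apply: nfew; exists n => k; apply/negP => mk;
    apply: nm; exists k.
exfalso; apply: nTA; pose X := [set w].
(* By [string_code_cat] the argument runs through the codes of the extensions of [t] by [k] bits. *)
pose F O n k := (\sum_(0 <= m < 2 ^ k)
  converges O c (string_code t + 2 ^ size t * ((2 ^ k).-1 + m)) n)%N.
have FE n k : F w n k = count (conv n) (strings k).
  rewrite /F (sum_strings (fun m =>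
    (converges w c (string_code t + 2 ^ size t * m) n : nat))).
  rewrite -sum1_count [RHS]big_mkcond /=.
  by apply: eq_bigr => s _; rewrite /conv string_code_cat; case: ifP.
(* With oracle [w], the truncated subtraction vanishes exactly when [many] holds, so [M] finds a
   stage for each [n]. *)
have [M cM hM] : exists2 M, computes X M & forall O n, X O ->
    ((2 * 2 ^ M O n).+1 - 3 * F O n (M O n) = 0)%N.
  apply: (computes_mu (P := fun O n k => ((2 * 2 ^ k).+1 - 3 * F O n k)%N)).
    rewrite /F; computability.
    by apply: computes_converges; computability.
  move=> O n ->; have [k] := exmany n; rewrite /many -FE => mk.
  by exists k; apply/eqP; rewrite subn_eq0.
have [comp_a _ aA] := enumA.
have [c' hc'] : computes X (fun O n =>
    ~~ (\sum_(0 <= i < size t + M O n) (a i == n) == 0))%N.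
  computability.
  by apply: (computes_fun (F := fun _ e => sndn e)) => //; computability.
exists c' => n; have := hc' w n erefl; congr (run _ _ _ (nat_of_bool _)).
apply/esym; rewrite /char_real.
have hMn : many n (M w n).
  by have := hM w n erefl; rewrite /many -FE => /eqP; rewrite subn_eq0.
rewrite big_mkord sum_nat_eq0; apply/idP/idP.
  rewrite inE -aA => -[i _ ai]; apply/forallPn => /=.
  (* An index [i] at or above the bound would satisfy [size t + M w n <= i.*2], which is excluded by
     [nmany]. *)
  have lt_i : (i < size t + M w n)%N.
    rewrite ltnNge; apply/negP => le_i; apply: nmany; exists i, (M w n).
      by rewrite ai.
    by apply: leq_trans le_i _; rewrite -addnn leq_addr.
  by exists (Ordinal lt_i); rewrite /= ai eqxx.
by move=> /forallPn[i]; rewrite eqb0 negbK => /eqP <-; rewrite inE -aA; exists (val i).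
Qed.

End Inversion.

(** By [cov_inversion] the success set has relative outer measure at most [2 / 3] in every cylinder,
    so by [cov0_density] it is null. *)
Lemma shuffle_no_inversion (R : realType) (A : set nat) (h : seq bool -> option bool)
    (a : nat -> nat) (w : cantor_space) (g : partial_map) :
  computable_enumeration A a -> ~ turing_le (char_real A) w ->
  partial_computable_in w g -> ~ probabilistic_inversion R g (as_partial (shuffle a h)).
Proof.
move=> enumA nTA [c hc]; rewrite /probabilistic_inversion Order.TotalTheory.ltNge.
apply/negP/negPn/uniform_mu_leP/cov0_density => t.
apply: (@cov_inversion R A h a enumA w c) => // v [y [r [-> ]]].
case E : (g _) => [z|//] [fz]; exists z; first exact/hc.
by move=> i; rewrite fz /real_join odd_double doubleK.
Qed.

Theorem corollary3p7 (R : realType) (A : set nat)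
    (h : seq bool -> option bool) (a : nat -> nat)
    (ceA : ce_set A) (ncA : ~ computable_set A)
    (hashA : is_hash A h) (enumA : computable_enumeration A a) :
  let f := shuffle a h in
  (total_computable (as_partial f) /\ random_preserving R (as_partial f)) /\
  (real_surjective f /\ nowhere_injective f) /\
  (forall w : cantor_space, ~ turing_le (char_real A) w ->
     oneway R w (as_partial f)).
Proof.
move=> f.
have f_comp : total_computable (as_partial f).
  exact: shuffle_total_computable hashA enumA.
have f_rand : random_preserving R (as_partial f).
  exact: shuffle_random_preserving hashA enumA R.
split=> //; split.
  split; first exact: (shuffle_surjective h enumA).
  exact: (shuffle_nowhere_injective ncA enumA).
move=> w nTA; split=> //; first by case: f_comp.
by move=> g; exact: shuffle_no_inversion enumA nTA.
Qed.
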